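(* Let $(A_{n})$ be a finite or countable list of separable $C^{*}$-algebras. Then $\bigoplus_{n}A_{n}$ is weakly projective if and only if each $A_{n}$ is weakly projective.
   Context: A separable $C^{*}$-algebra $A$ is weakly projective if, for every $*$-homomorphism $\varphi:A\rightarrow C$ and every surjective $*$-homomorphism $\rho:B\rightarrow C$ of arbitrary (not necessarily unital) $C^{*}$-algebras, there is a sequence $\varphi_{n}:A\rightarrow B$ of $*$-homomorphisms so that $\rho\circ\varphi_{n}\rightarrow\varphi$, meaning $\lim_{n\to\infty}\|\rho(\varphi_{n}(a))-\varphi(a)\|=0$ for each $a\in A$. The direct sum $\bigoplus_{n}A_{n}$ is the $C^{*}$-algebraic ($c_{0}$-) direct sum: families $\langle a_{n}\rangle$ with $a_{n}\in A_{n}$ and, when the list is infinite, $\|a_{n}\|\to 0$, with the supremum norm. *)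

(* Defs.v *)
From HB Require Import structures.
From mathcomp Require Import all_boot all_order all_algebra.
From mathcomp Require Import complex.
From mathcomp Require Import mathcomp_extra boolp classical_sets functions.
From mathcomp Require Import cardinality filter reals topology normedtype.
From mathcomp Require Import sequences.

Set Implicit Arguments.
Unset Strict Implicit.
Unset Printing Implicit Defensive.

Import Order.TTheory GRing.Theory Num.Theory.
Import numFieldNormedType.Exports.

Local Open Scope classical_set_scope.
Local Open Scope ring_scope.
Local Open Scope complex_scope.

(* Not necessarily unital C*-algebras. As for every normed module over R[i],
   the norm takes its (real, nonnegative) values in R[i]. *)
HB.mixin Record isCStarAlgebra (R : realType) A
    & CompleteNormedModule R[i] A := {
  csmul : A -> A -> A;
  csadj : A -> A;
  csmulA : associative csmul;
  csmulDl : left_distributive csmul +%R;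
  csmulDr : right_distributive csmul +%R;
  csmulZl : forall (c : R[i]) (x y : A), csmul (c *: x) y = c *: csmul x y;
  csmulZr : forall (c : R[i]) (x y : A), csmul x (c *: y) = c *: csmul x y;
  csnormM : forall x y : A, `|csmul x y| <= `|x| * `|y|;
  csadjK : involutive csadj;
  csadjD : {morph csadj : x y / x + y};
  csadjZ : forall (c : R[i]) (x : A), csadj (c *: x) = c^* *: csadj x;
  csadjM : forall x y : A, csadj (csmul x y) = csmul (csadj y) (csadj x);
  csnorm_adj : forall x : A, `|csmul (csadj x) x| = `|x| ^+ 2
}.

#[short(type="cstarType")]
HB.structure Definition CStarAlgebra (R : realType) :=
  {A of CompleteNormedModule R[i] A & isCStarAlgebra R A}.

Definition star_hom (R : realType) (A B : cstarType R) (f : A -> B) : Prop :=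
  [/\ linear f, {morph f : x y / csmul x y} & {morph f : x / csadj x}].

Definition separable (T : topologicalType) : Prop :=
  exists D : set T, countable D /\ dense D.

(* R[i]^o, and not R[i], is the type for which the library finds the topology
   of the field R[i]. *)
Definition weakly_projective (R : realType) (A : cstarType R) : Prop :=
  separable A /\
  forall (B C : cstarType R) (phi : A -> C) (rho : B -> C),
    star_hom phi -> star_hom rho -> set_surj setT setT rho ->
    exists phi_ : nat -> A -> B,
      (forall n, star_hom (phi_ n)) /\
      forall a : A,
        (`|rho (phi_ n a) - phi a| : R[i]^o) @[n --> \oo] --> (0 : R[i]^o).

(* The cofinite filter makes this the usual convergence to 0 of a sequence
   when I is nat, and makes it void when I is finite. *)
Definition vanishing (R : realType) (I : countType) (A : I -> cstarType R)
    (a : forall i, A i) : Prop :=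
  (`|a i| : R[i]^o) @[i --> (@frechet_filter I : set_system I)] --> (0 : R[i]^o).

Record c0sum (R : realType) (I : countType) (A : I -> cstarType R) := C0Sum {
  c0val :> forall i, A i;
  c0valP : vanishing c0val
}.

Section C0Sum.
Context {R : realType} {I : countType} (A : I -> cstarType R).
Local Notation S := (c0sum A).
Implicit Types (a b : S) (f g : forall i, A i).

Lemma c0sumP a b : (forall i, a i = b i) -> a = b.
Proof.
case: a b => [a pa] [b pb] /= ab.
have {}ab : a = b by apply: functional_extensionality_dep.
by rewrite ab in pa *; congr C0Sum; apply: Prop_irrelevance.
Qed.

Lemma normCre (V : normedZmodType R[i]) (x : V) : (complex.Re `|x|)%:C = `|x|.
Proof. by rewrite RRe_real// ger0_real. Qed.

Lemma Renorm_ge0 (V : normedZmodType R[i]) (x : V) : 0 <= complex.Re `|x|.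
Proof. by rewrite -(@lecR R 0) normCre; exact: normr_ge0. Qed.

Lemma posCre (e : R[i]) : 0 < e -> exists2 d : R, 0 < d & e = d%:C.
Proof.
move=> e0; exists (complex.Re e); last by rewrite RRe_real// gtr0_real.
by rewrite -ltcR RRe_real// gtr0_real.
Qed.

#[local] Instance frechet_filter_filter : Filter (@frechet_filter I).
Proof.
rewrite /frechet_filter; constructor; first by rewrite /= setCT.
- by move=> ? ?; rewrite /= setCI finite_setU.
- by move=> P Q PQ; exact/sub_finite_set/subsetC.
Qed.


Lemma vanishingP f : vanishing f <->
  forall e : R, 0 < e -> finite_set [set i | e%:C <= `|f i|].
Proof.
have key (e : R) : ~` [set i | `|(0 : R[i]^o) - (`|f i| : R[i]^o)| < e%:C] =
    [set i | e%:C <= `|f i|].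
  apply/seteqP; split => i /=; rewrite sub0r normrN normr_id -normCre lecR ltcR.
    by move/negP; rewrite -leNgt.
  by move=> h; apply/negP; rewrite -leNgt.
split.
- move=> vf e e0; rewrite -key.
  have ec0 : 0 < e%:C by rewrite ltcR.
  exact: (vf _ (nbhsx_ballx (0 : R[i]^o) _ ec0)).
- move=> vf; apply/cvg_ballP => e /posCre[d d0 ->].
  by have := vf d d0; rewrite -key.
Qed.

Lemma vanishing_sub f g : vanishing f -> (forall i, `|g i| <= `|f i|) ->
  vanishing g.
Proof.
move=> /vanishingP vf gf; apply/vanishingP => e /vf.
by apply: sub_finite_set => i /= /le_trans; apply.
Qed.

Lemma vanishingD f g : vanishing f -> vanishing g ->
  vanishing (fun i => f i + g i).
Proof.
move=> /vanishingP vf /vanishingP vg; apply/vanishingP => e e0.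
have e20 : 0 < e / 2 by rewrite divr_gt0.
have := vf _ e20; have := vg _ e20 => fg ff.
apply: (@sub_finite_set _ _
  ([set i | (e / 2)%:C <= `|f i|] `|` [set i | (e / 2)%:C <= `|g i|])).
  move=> i /= h; have := le_trans h (ler_normD _ _).
  rewrite -(normCre (f i)) -(normCre (g i)) -rmorphD /= !lecR => {}h.
  have [|lf] := leP (e / 2) (complex.Re `|f i|); first by left.
  right; rewrite leNgt; apply/negP => lg.
  by have := ltrD lf lg; rewrite -splitr ltNge h.
by rewrite finite_setU.
Qed.

Lemma vanishingZ (c : R[i]) f : vanishing f -> vanishing (fun i => c *: f i).
Proof.
move=> /vanishingP vf; apply/vanishingP => e e0.
have c0 : 0 < complex.Re `|c| + 1.
  by rewrite ltr_wpDl// Renorm_ge0.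
apply: sub_finite_set (vf (e / (complex.Re `|c| + 1)) _); last exact: divr_gt0.
move=> i /=; rewrite normrZ -normCre -(normCre (f i)) -rmorphM /= !lecR => h.
by rewrite ler_pdivrMr// mulrC (le_trans h)// ler_wpM2r ?lerDl// Renorm_ge0.
Qed.

Lemma vanishing0 : vanishing (fun i => 0 : A i).
Proof.
apply/vanishingP => e e0; apply: sub_finite_set (finite_set0 I) => i /=.
by rewrite normr0 lecR leNgt e0.
Qed.

Lemma vanishingM f g : vanishing f -> vanishing g ->
  vanishing (fun i => csmul (f i) (g i)).
Proof.
move=> /vanishingP vf /vanishingP vg; apply/vanishingP => e e0.
apply: (@sub_finite_set _ _
  ([set i | 1%:C <= `|f i|] `|` [set i | e%:C <= `|g i|])).
  move=> i /= h; have := le_trans h (csnormM _ _).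
  rewrite -(normCre (f i)) -(normCre (g i)) -rmorphM /= !lecR => {}h.
  have [|lf] := leP 1 (complex.Re `|f i|); first by left.
  right; rewrite (le_trans h)// ler_piMl ?(ltW lf)//.
  exact: Renorm_ge0.
by rewrite finite_setU; split; [exact: vf|exact: vg].
Qed.

Lemma csnormJ (B : cstarType R) (x : B) : `|csadj x| = `|x|.
Proof.
suff le (y : B) : `|y| <= `|csadj y|.
  by apply/eqP; rewrite eq_le le andbT -{2}(csadjK x) le.
have [->|y0] := eqVneq y 0; first by rewrite normr0.
have yp : 0 < `|y| by rewrite normr_gt0.
rewrite -(ler_pM2r yp) -expr2 -csnorm_adj; exact: csnormM.
Qed.

Lemma vanishing_adj f : vanishing f -> vanishing (fun i => csadj (f i)).
Proof. by move=> vf; apply: vanishing_sub vf _ => i; rewrite csnormJ. Qed.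

HB.instance Definition _ := gen_eqMixin S.
HB.instance Definition _ := gen_choiceMixin S.

Definition c0zero : S := C0Sum vanishing0.
Definition c0add a b : S := C0Sum (vanishingD (c0valP a) (c0valP b)).
Definition c0scale (c : R[i]) a : S := C0Sum (vanishingZ c (c0valP a)).
Definition c0opp a : S := c0scale (-1) a.
Definition c0mul a b : S := C0Sum (vanishingM (c0valP a) (c0valP b)).
Definition c0adj a : S := C0Sum (vanishing_adj (c0valP a)).

Fact c0addA : associative c0add.
Proof. by move=> a b c; apply: c0sumP => i /=; rewrite addrA. Qed.
Fact c0addC : commutative c0add.
Proof. by move=> a b; apply: c0sumP => i /=; rewrite addrC. Qed.
Fact c0add0 : left_id c0zero c0add.
Proof. by move=> a; apply: c0sumP => i /=; rewrite add0r. Qed.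
Fact c0addN : left_inverse c0zero c0opp c0add.
Proof. by move=> a; apply: c0sumP => i /=; rewrite scaleN1r addNr. Qed.

HB.instance Definition _ :=
  GRing.isZmodule.Build S c0addA c0addC c0add0 c0addN.

Fact c0scaleA c d a : c0scale c (c0scale d a) = c0scale (c * d) a.
Proof. by apply: c0sumP => i /=; rewrite scalerA. Qed.
Fact c0scale1 : left_id 1 c0scale.
Proof. by move=> a; apply: c0sumP => i /=; rewrite scale1r. Qed.
Fact c0scaleDr : right_distributive c0scale +%R.
Proof. by move=> c a b; apply: c0sumP => i /=; rewrite scalerDr. Qed.
Fact c0scaleDl a : {morph c0scale^~ a : c d / c + d}.
Proof. by move=> c d; apply: c0sumP => i /=; rewrite scalerDl. Qed.

HB.instance Definition _ := GRing.Zmodule_isLmodule.Build R[i] S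
  c0scaleA c0scale1 c0scaleDr c0scaleDl.

Lemma c0valD a b i : (a + b) i = a i + b i. Proof. by []. Qed.
Lemma c0valZ (c : R[i]) a i : (c *: a) i = c *: a i. Proof. by []. Qed.
Lemma c0val0 i : (0 : S) i = 0. Proof. by []. Qed.
Lemma c0valN a i : (- a) i = - a i. Proof. exact: scaleN1r. Qed.
Lemma c0valB a b i : (a - b) i = a i - b i.
Proof. by rewrite c0valD c0valN. Qed.

(* The supremum is taken in R, in which it is 0 when I is empty. *)
Definition c0norm a : R[i] :=
  (sup (range (fun i => complex.Re `|a i|)))%:C.

Lemma c0norm_has_ubound a :
  has_ubound (range (fun i => complex.Re `|a i|)).
Proof.
have /vanishingP/(_ 1 ltr01)/finite_seqP[s sE] := c0valP a.
have re0 i : 0 <= complex.Re `|a i| by exact: Renorm_ge0.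
exists (1 + \sum_(j <- s) complex.Re `|a j|) => _ [i _ <-].
have [h|/ltW h] := leP 1 (complex.Re `|a i|).
  have : [set` s] i by rewrite -sE /= -normCre lecR.
  move=> /= /(perm_to_rem) si.
  rewrite (perm_big _ si) big_cons /= addrCA lerDl addr_ge0//.
  exact: sumr_ge0.
by rewrite (le_trans h)// lerDl sumr_ge0.
Qed.

Lemma c0norm_ge a i : `|a i| <= c0norm a.
Proof.
rewrite -normCre lecR; apply: ub_le_sup; first exact: c0norm_has_ubound.
by exists i.
Qed.

Lemma c0norm_le a (M : R[i]) : 0 <= M -> (forall i, `|a i| <= M) ->
  c0norm a <= M.
Proof.
move=> M0 aM; rewrite -(RRe_real (ger0_real M0)) lecR.
have [->|/set0P ne] :=
    eqVneq (range (fun i => complex.Re `|a i|)) (set0 : set R).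
  by rewrite sup0 -lecR RRe_real// ger0_real.
apply: ge_sup => // _ [i _ <-].
by move: (aM i); rewrite -(normCre (a i)) -(RRe_real (ger0_real M0)) lecR.
Qed.

Lemma c0norm_ge0 a : 0 <= c0norm a.
Proof.
have [E|/set0P[_ [i _ _]]] :=
    eqVneq (range (fun i => complex.Re `|a i|)) (set0 : set R).
  by rewrite /c0norm E sup0.
exact: le_trans (normr_ge0 (a i)) (c0norm_ge a i).
Qed.

Fact c0normD a b : c0norm (a + b) <= c0norm a + c0norm b.
Proof.
apply: c0norm_le => [|i]; first by rewrite addr_ge0 ?c0norm_ge0.
by rewrite c0valD (le_trans (ler_normD _ _))// lerD ?c0norm_ge.
Qed.

Fact c0normZ (c : R[i]) a : c0norm (c *: a) = `|c| * c0norm a.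
Proof.
apply: le_anti; apply/andP; split.
  apply: c0norm_le => [|i]; first by rewrite mulr_ge0 ?c0norm_ge0.
  by rewrite c0valZ normrZ ler_wpM2l ?c0norm_ge.
have [->|c0] := eqVneq c 0; first by rewrite normr0 mul0r c0norm_ge0.
rewrite mulrC -ler_pdivlMr ?normr_gt0//.
apply: c0norm_le => [|i]; first by rewrite divr_ge0 ?c0norm_ge0.
by rewrite ler_pdivlMr ?normr_gt0// mulrC -normrZ -c0valZ c0norm_ge.
Qed.

Fact c0norm_eq0 a : c0norm a = 0 -> a = 0.
Proof.
move=> a0; apply: c0sumP => i; apply/normr0_eq0/le_anti.
by rewrite normr_ge0 -a0 c0norm_ge.
Qed.

HB.instance Definition _ := Lmodule_isNormed.Build R[i] S
  c0normD c0normZ c0norm_eq0.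

Lemma c0normE a : `|a| = c0norm a. Proof. by []. Qed.

Fact c0sum_complete (F : set_system S) :
  ProperFilter F -> cauchy F -> cvg F.
Proof.
move=> FF /cauchyP Fc.
have cvgi i : cvg ((fun a : S => a i) @ F).
  apply: cauchy_cvg; apply: cauchy_exP => e e0.
  have [a Fa] := Fc _ e0; exists (a i).
  change (F ((fun b : S => b i) @^-1` ball (a i) e)).
  apply: filterS Fa => b; rewrite -!ball_normE /= => ab.
  by rewrite -c0valB (le_lt_trans _ ab)// c0norm_ge.
pose l i : A i := lim ((fun a : S => a i) @ F).
have near_l (e : R[i]) a i : 0 < e -> F (ball a e) -> `|a i - l i| <= e.
  move=> e0 Fa; have [d d0 de] := posCre e0.
  rewrite -normCre de lecR; apply/ler_addgt0Pr => h h0.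
  have hc0 : 0 < h%:C by rewrite ltcR.
  have Fl : F [set b : S | ball (l i) h%:C (b i)].
    exact: (cvgi i _ (nbhsx_ballx (l i) _ hc0)).
  have [b [/= ab lb]] := filter_ex (filterI Fa Fl).
  rewrite -lecR normCre rmorphD /= -de -(subrKA (b i)).
  rewrite (le_trans (ler_normD _ _))// lerD//.
    move: ab; rewrite -ball_normE /= => /ltW; apply: le_trans.
    by rewrite -c0valB c0norm_ge.
  by move: lb; rewrite -ball_normE /= distrC => /ltW.
have half (e : R[i]) : 0 < e -> 0 < e / 2 by move=> e0; rewrite divr_gt0.
have vl : vanishing l.
  apply/vanishingP => e e0.
  have e20 : 0 < (e / 2)%:C by rewrite ltcR divr_gt0.
  have [a Fa] := Fc _ e20.
  have /vanishingP/(_ (e / 2)) := c0valP a.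
  rewrite divr_gt0// => /(_ isT); apply: sub_finite_set => i /= h.
  have := le_trans h (_ : _ <= `|a i| + `|a i - l i|).
  have -> : `|l i| <= `|a i| + `|a i - l i|.
    by rewrite distrC -lerBlDl lerB_dist.
  move=> /(_ isT); have := near_l _ a i e20 Fa.
  rewrite -(normCre (a i)) -(normCre (a i - l i)) -rmorphD /= !lecR => h1 h2.
  by rewrite -(lerD2r (e / 2)) -splitr (le_trans h2)// lerD2l.
apply/cvg_ex; exists (C0Sum vl); apply/cvg_ballP => e e0.
have [a Fa] := Fc _ (half _ e0).
have al : `|a - C0Sum vl| <= e / 2.
  apply: c0norm_le => [|i]; first by apply/ltW; exact: half.
  by rewrite c0valB; apply: near_l Fa; exact: half.
apply: filterS Fa => b; rewrite -!ball_normE /= => ab.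
rewrite (splitr e) -(subrKA a) (le_lt_trans (ler_normD _ _))//.
by rewrite ler_ltD// distrC.
Qed.

HB.instance Definition _ := Uniform_isComplete.Build S c0sum_complete.

Fact c0mulA : associative c0mul.
Proof. by move=> a b c; apply: c0sumP => i /=; rewrite csmulA. Qed.
Fact c0mulDl : left_distributive c0mul +%R.
Proof. by move=> a b c; apply: c0sumP => i /=; rewrite csmulDl. Qed.
Fact c0mulDr : right_distributive c0mul +%R.
Proof. by move=> a b c; apply: c0sumP => i /=; rewrite csmulDr. Qed.
Fact c0mulZl (c : R[i]) a b : c0mul (c *: a) b = c *: c0mul a b.
Proof. by apply: c0sumP => i /=; rewrite csmulZl. Qed.
Fact c0mulZr (c : R[i]) a b : c0mul a (c *: b) = c *: c0mul a b.
Proof. by apply: c0sumP => i /=; rewrite csmulZr. Qed.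
Fact c0normM a b : `|c0mul a b| <= `|a| * `|b|.
Proof.
apply: c0norm_le => [|i]; first by rewrite mulr_ge0.
by rewrite (le_trans (csnormM _ _))// ler_pM ?c0norm_ge.
Qed.
Fact c0adjK : involutive c0adj.
Proof. by move=> a; apply: c0sumP => i /=; rewrite csadjK. Qed.
Fact c0adjD : {morph c0adj : a b / a + b}.
Proof. by move=> a b; apply: c0sumP => i /=; rewrite csadjD. Qed.
Fact c0adjZ (c : R[i]) a : c0adj (c *: a) = c^* *: c0adj a.
Proof. by apply: c0sumP => i /=; rewrite csadjZ. Qed.
Fact c0adjM a b : c0adj (c0mul a b) = c0mul (c0adj b) (c0adj a).
Proof. by apply: c0sumP => i /=; rewrite csadjM. Qed.
Fact c0norm_adj a : `|c0mul (c0adj a) a| = `|a| ^+ 2.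
Proof.
have adjle : `|c0adj a| <= `|a|.
  by apply: c0norm_le => // i; rewrite csnormJ c0norm_ge.
apply: le_anti; apply/andP; split.
  by rewrite (le_trans (c0normM _ _))// expr2 ler_wpM2r.
pose x := complex.Re `|c0mul (c0adj a) a|.
have x0 : 0 <= x by exact: Renorm_ge0.
rewrite -[leRHS]normCre -/x -(sqr_sqrtr x0) rmorphXn /=.
have s0 : 0 <= (Num.sqrt x)%:C by rewrite lecR sqrtr_ge0.
rewrite (ler_pXn2r _ (normr_ge0 a) s0)//.
apply: c0norm_le => // i.
rewrite -(ler_pXn2r (isT : (0 < 2)%N) (normr_ge0 (a i)) s0).
rewrite -rmorphXn /= sqr_sqrtr// -csnorm_adj normCre.
exact: (c0norm_ge (c0mul (c0adj a) a)).
Qed.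

HB.instance Definition _ := isCStarAlgebra.Build R S
  c0mulA c0mulDl c0mulDr c0mulZl c0mulZr c0normM
  c0adjK c0adjD c0adjZ c0adjM c0norm_adj.

Lemma c0valM a b i : csmul a b i = csmul (a i) (b i). Proof. by []. Qed.
Lemma c0val_adj a i : csadj a i = csadj (a i). Proof. by []. Qed.

End C0Sum.

(* Main.v *)
Require Import Defs.
From HB Require Import structures.
From mathcomp Require Import all_boot all_order all_algebra.
From mathcomp Require Import complex ring lra zify.
From mathcomp Require Import mathcomp_extra boolp classical_sets functions.
From mathcomp Require Import cardinality reals topology normedtype.
From mathcomp Require Import sequences.

(** A summand is a retract of the sum, so it inherits weak projectivity:
    precompose with the projection, lift, restrict (weakly_projective_summand).

    For the converse let [f : B -> C] be onto and let [phi] be a homomorphism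
    from the sum to [C]. Finitely supported elements are dense in the sum and
    homomorphisms are contractive, so it suffices to lift approximately the
    restrictions [phi i] of [phi] to finitely many summands, by homomorphisms
    with pairwise orthogonal ranges: these add up to a homomorphism on the sum
    (approx_lift). Orthogonality is arranged before lifting. By
    orthogonal_family there are pairwise orthogonal closed self-adjoint
    subalgebras [E i] of [B] such that [f (E i)] contains the range of [phi i].
    The pullback of the pairs [(a, b)] with [b] in [E i] and
    [phi i a = f b] then maps onto [A i]; weak projectivity, applied to the
    identity of [A i], lifts it approximately to this pullback, and the second
    components are approximate lifts of [phi i] with values in [E i]
    (weakly_projective_lift).

    To find the [E i], separate one summand at a time from the others. The
    separable algebra [A i] has a strictly positive element [p i]
    (exists_strictly_pos). The images [k] of [p i] and [l] of the sum of the
    other [p j] are positive with [k l = 0]. Lift [k - l] to a self-adjoint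
    [x] and put [m = |x|], the positive square root of [x^2]. Then [m + x] and
    [m - x] are orthogonal, and they lie over [2 k] and [2 l] since
    [f m = k + l] by uniqueness of positive square roots (sqrt_uniq). Two
    mutually annihilating subalgebras, one containing [(m + x) B (m + x)] and
    one containing [(m - x) B (m - x)], are therefore orthogonal with images
    that contain [k C k] and [l C l] (orthogonal_lift). These images are closed
    (mclosed_image), and [p i] is strictly positive, so they contain the ranges
    of the [phi j].

    The facts about C*-algebras that this needs are obtained without spectral
    theory. In the multiplier algebra, which has a unit [e], a self-adjoint [a]
    is called positive if [|| l e - a || <= l] for some real [l]; then sums of
    positive elements are trivially positive. Square roots are limits of the
    iteration [b := (y + b^2) / 2] and resolvents [a (1 + a)^-1] are fixed
    points of a contraction. The norm estimates all come from comm_squares: for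
    commuting self-adjoint [x] and [y] one has [||x||^2 <= ||x^2 + y^2||],
    because [x] is the real part of [x + i y]. *)


Set Implicit Arguments.
Unset Strict Implicit.
Unset Printing Implicit Defensive.
Import Order.TTheory GRing.Theory Num.Theory.
Import numFieldNormedType.Exports.
Local Open Scope classical_set_scope.
Local Open Scope ring_scope.
Local Open Scope complex_scope.

(** * A decision procedure for identities between linear combinations *)

(** A monomial in a noncommutative algebra is treated as a variable of a linear
    combination, which is compared coefficient by coefficient. The coefficients
    stay symbolic, so that their equality is a commutative ring identity. *)
Inductive lin (K : Type) :=
  LZero | LVar of nat | LAdd of lin K & lin K | LOpp of lin K
| LScale of K & lin K.
Arguments LZero {K}.
Arguments LVar {K}.

Section Lin.
Context {K : comPzRingType} {V : lmodType K}.
Implicit Types (env : seq V) (e : lin K).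

Fixpoint leval env e : V :=
  match e with
  | LZero => 0
  | LVar i => env`_i
  | LAdd e1 e2 => leval env e1 + leval env e2
  | LOpp e1 => - leval env e1
  | LScale c e1 => c *: leval env e1
  end.

Fixpoint lcoef e (i : nat) : K :=
  match e with
  | LZero => 0
  | LVar j => if eqn i j then 1 else 0
  | LAdd e1 e2 => lcoef e1 i + lcoef e2 i
  | LOpp e1 => - lcoef e1 i
  | LScale c e1 => c * lcoef e1 i
  end.

Fixpoint lcoef_eq e1 e2 (n : nat) : Prop :=
  if n is n'.+1 then lcoef e1 n' = lcoef e2 n' /\ lcoef_eq e1 e2 n' else True.

Lemma levalE env e :
  leval env e = \sum_(i < size env) lcoef e i *: env`_i.
Proof.
elim: e => [|j|e1 IH1 e2 IH2|e IH|c e IH] /=.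
- by rewrite big1// => i _; rewrite scale0r.
- have [jlt|jge] := ltnP j (size env).
    rewrite (bigD1 (Ordinal jlt))//= big1 ?addr0 => [|i].
      by rewrite (_ : eqn j j) ?scale1r//; exact: (eqxx j).
    move=> /eqP ij; case: ifP => [/eqnP E|]; last by rewrite scale0r.
    by case: ij; apply: val_inj.
  rewrite nth_default// big1// => i _; case: ifP; last by rewrite scale0r.
  by move=> /eqnP E; have := ltn_ord i; rewrite E ltnNge jge.
- by rewrite IH1 IH2 -big_split; apply: eq_bigr => i _; rewrite scalerDl.
- by rewrite IH -sumrN; apply: eq_bigr => i _; rewrite scaleNr.
- by rewrite IH scaler_sumr; apply: eq_bigr => i _; rewrite scalerA.
Qed.

Lemma leval_eq env e1 e2 :
  lcoef_eq e1 e2 (size env) -> leval env e1 = leval env e2.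
Proof.
move=> h; rewrite !levalE; apply: eq_bigr => -[i /= il] _; congr (_ *: _).
elim: (size env) il h => [//|n IH]; rewrite ltnS leq_eqVlt.
by move=> /orP[/eqP->|/IH{}IH] [].
Qed.
End Lin.

Ltac lin_index x env :=
  match env with
  | (?y :: ?env')%SEQ => match constr:(Set) with
     | _ => let _ := match constr:(Set) with _ => constr_eq x y end in constr:(0%N)
     | _ => let n := lin_index x env' in constr:(n.+1)
     end
  end.
Ltac lin_mem x env :=
  match env with
  | (?y :: ?env')%SEQ => match constr:(Set) with
     | _ => let _ := match constr:(Set) with _ => constr_eq x y end in constr:(true)
     | _ => lin_mem x env'
     end
  | _ => constr:(false)
  end.
Ltac lin_atoms t env :=
  lazymatch t with
  | (?x + ?y)%R => let env := lin_atoms x env in lin_atoms y env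
  | (- ?x)%R => lin_atoms x env
  | (?c *: ?x)%R => lin_atoms x env
  | (0)%R => env
  | _ => let b := lin_mem t env in
         lazymatch b with true => env | false => constr:((t :: env)%SEQ) end
  end.
Ltac lin_reify K t env :=
  lazymatch t with
  | (?x + ?y)%R => let a := lin_reify K x env in let b := lin_reify K y env in
                   constr:(@LAdd K a b)
  | (- ?x)%R => let a := lin_reify K x env in constr:(@LOpp K a)
  | (?c *: ?x)%R => let a := lin_reify K x env in constr:(@LScale K c a)
  | (0)%R => constr:(@LZero K)
  | _ => let n := lin_index t env in constr:(@LVar K n)
  end.
(** Leaves the equations between coefficients; variables are identified
    syntactically. *)
Ltac lin_coefs :=
  lazymatch goal with
  | |- @eq (@CStarAlgebra.sort _ _) _ _ => idtac
  | |- @eq _ ?x ?y => refine (_ : @eq (@CStarAlgebra.sort _ _) x y)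
  end;
  lazymatch goal with
  | |- @eq (@CStarAlgebra.sort ?R ?A) ?x ?y =>
    let env1 := lin_atoms x (@nil (@CStarAlgebra.sort R A)) in
    let env := lin_atoms y env1 in
    let a := lin_reify (R[i]) x env in
    let b := lin_reify (R[i]) y env in
    change (@leval _ (A : lmodType R[i]) env a =
            @leval _ (A : lmodType R[i]) env b);
    apply: leval_eq; cbn [lcoef_eq lcoef eqn size]; repeat split
  end.

(** * Algebra and norm of a C*-algebra *)

Declare Scope cstar_scope.
Notation "x ** y" := (csmul x y) (at level 40, left associativity) : cstar_scope.
Notation "x ^#" := (csadj x) (at level 2, format "x ^#") : cstar_scope.
Local Open Scope cstar_scope.

(** The imaginary unit in coordinates, so that its conjugate computes. *)
Definition imc (R : realType) : R[i] := Complex 0 1.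
Lemma imcM (R : realType) : imc R * imc R = -1.
Proof. by apply/eqP; rewrite eq_complex; apply/andP; split; apply/eqP => /=; ring. Qed.

Section Algebra.
Context {R : realType} {A : cstarType R}.
Implicit Types (x y z : A).

Lemma csmul0l x : 0 ** x = 0.
Proof. by apply: (addrI (0 ** x)); rewrite -csmulDl !addr0. Qed.
Lemma csmul0r x : x ** 0 = 0.
Proof. by apply: (addrI (x ** 0)); rewrite -csmulDr !addr0. Qed.
Lemma csmulNl x y : - x ** y = - (x ** y).
Proof. by apply: (addrI (x ** y)); rewrite -csmulDl !subrr csmul0l. Qed.
Lemma csmulNr x y : x ** - y = - (x ** y).
Proof. by apply: (addrI (x ** y)); rewrite -csmulDr !subrr csmul0r. Qed.
Lemma csadj0 : (0 : A)^# = 0.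
Proof. by apply: (addrI (0 : A)^#); rewrite -csadjD !addr0. Qed.
Lemma csadjN x : (- x)^# = - x^#.
Proof. by apply: (addrI x^#); rewrite -csadjD !subrr csadj0. Qed.
Lemma csadjZr (r : R) x : (r%:C *: x)^# = r%:C *: x^#.
Proof. by rewrite csadjZ; congr (_ *: _); exact: conjc_real. Qed.
Lemma csadjZi x : (imc R *: x)^# = - (imc R *: x^#).
Proof.
rewrite csadjZ -scaleNr; congr (_ *: _).
by apply/eqP; rewrite eq_complex; apply/andP; split; apply/eqP => /=; ring.
Qed.
End Algebra.

(** Expands a *-polynomial expression into a linear combination of words. *)
Definition csE := (@csmul0l, @csmul0r, @csmulDl, @csmulDr, @csmulNl, @csmulNr,
  @csmulZl, @csmulZr, @csmulA, @csadj0, @csadjD, @csadjN, @csadjZr, @csadjZi,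
  @csadjM, @csadjK).

Ltac cslin := rewrite ?csE; lin_coefs; ring.
Ltac cslin_field := rewrite ?csE; lin_coefs; field; rewrite ?fmorph_eq0 //.

Section Norm.
Context {R : realType} {A : cstarType R}.
Implicit Types (x y z : A).

(** The norm as a real number. *)
Definition nr x : R := complex.Re `|x|.

Lemma nrE x : (nr x)%:C = `|x|. Proof. exact: normCre. Qed.
Lemma nr_ge0 x : 0 <= nr x. Proof. exact: Renorm_ge0. Qed.
Lemma nr0 : nr 0 = 0. Proof. by rewrite /nr normr0. Qed.
Lemma nr_eq0 x : nr x = 0 -> x = 0.
Proof. by move=> x0; apply/normr0_eq0; rewrite -nrE x0. Qed.
Lemma nr_le0 x : nr x <= 0 -> x = 0.
Proof. by move=> x0; apply/nr_eq0/le_anti; rewrite x0 nr_ge0. Qed.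
Lemma nrD x y : nr (x + y) <= nr x + nr y.
Proof. by rewrite -lecR rmorphD /= !nrE ler_normD. Qed.
Lemma nrN x : nr (- x) = nr x. Proof. by rewrite /nr normrN. Qed.
Lemma nrB x y : nr (x - y) = nr (y - x). Proof. by rewrite -nrN opprB. Qed.
Lemma nrBD x y : nr (x - y) <= nr x + nr y.
Proof. by rewrite -(nrN y) nrD. Qed.
Lemma nr_tri y x z : nr (x - z) <= nr (x - y) + nr (y - z).
Proof. by rewrite -{1}(subrK y x) -addrA nrD. Qed.
Lemma nrZc (c : R[i]) x : nr (c *: x) = complex.Re `|c| * nr x.
Proof. by apply: complexI; rewrite rmorphM /= nrE normrZ -!nrE normCre. Qed.
Lemma nrZ (r : R) x : nr (r%:C *: x) = `|r| * nr x.
Proof.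
rewrite /nr normrZ normc_def /= expr0n addr0 sqrtr_sqr -(nrE x).
by rewrite -rmorphM.
Qed.
Lemma nrM x y : nr (x ** y) <= nr x * nr y.
Proof. by rewrite -lecR rmorphM /= !nrE csnormM. Qed.
Lemma nrJ x : nr x^# = nr x. Proof. by rewrite /nr csnormJ. Qed.
Lemma nr_adjM x : nr (x^# ** x) = nr x ^+ 2.
Proof.
by apply: complexI; rewrite rmorphXn /= !nrE csnorm_adj.
Qed.
Lemma nr_sum (I : Type) (s : seq I) (F : I -> A) :
  nr (\sum_(i <- s) F i) <= \sum_(i <- s) nr (F i).
Proof.
elim: s => [|i s IH]; first by rewrite !big_nil nr0.
by rewrite !big_cons (le_trans (nrD _ _))// lerD2l.
Qed.
End Norm.

Lemma expr_small (R : realType) (r d : R) :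
  0 <= r -> r < 1 -> 0 < d -> exists n, r ^+ n < d.
Proof.
move=> r0 r1 d0; have : r ^+ n @[n --> \oo] --> 0.
  by apply: cvg_expr; rewrite ger0_norm.
move=> /cvgrPdist_lt/(_ _ d0)[N _ NP]; exists N.
by have := NP N (leqnn N); rewrite sub0r normrN ger0_norm// exprn_ge0.
Qed.

Section Complete.
Context {R : realType} {A : cstarType R}.

(** The increments of [b] dominate those of [u], so [M - b n] bounds the
    remaining distance; the modulus of convergence is what later proofs use. *)
Lemma cs_lim (u : nat -> A) (b : nat -> R) (M : R) :
  (forall n, b n <= M) ->
  (forall e, 0 < e -> exists n, M - b n < e) ->
  (forall n, nr (u n.+1 - u n) <= b n.+1 - b n) ->
  exists l, forall n, nr (l - u n) <= M - b n.
Proof.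
move=> bM bl ub.
have mono n k : nr (u (n + k)%N - u n) <= b (n + k)%N - b n.
  elim: k => [|k IH]; first by rewrite addn0 !subrr nr0.
  rewrite addnS; apply: le_trans (nr_tri (u (n + k)%N) _ _) _.
  by have := ub (n + k)%N; lra.
have uM n m : (n <= m)%N -> nr (u m - u n) <= M - b n.
  by move=> /subnKC <-; apply: le_trans (mono _ _) _; rewrite lerD2r.
have /cvg_ex[l ul] : cvg (u @ \oo).
  apply: cauchy_cvg; apply: cauchy_exP => e /posCre[d d0 ->].
  have [n bn] := bl _ d0; exists (u n); exists n => //= m nm.
  rewrite -ball_normE /= -nrE ltcR nrB (le_lt_trans _ bn)//; exact: uM.
exists l => n; apply/ler_addgt0Pr => e e0.
have ec0 : 0 < e%:C :> R[i] by rewrite ltcR.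
have [N _ uN] := ul _ (nbhsx_ballx l _ ec0).
have := uN (N + n)%N (leq_addr _ _); rewrite /= -ball_normE /= -nrE ltcR.
have := uM _ _ (leq_addl N n); have := nr_tri (u (N + n)%N) l (u n); lra.
Qed.
End Complete.

(** * Closed subalgebras and square roots *)

Section Closed.
Context {R : realType} {A : cstarType R}.
Implicit Types (x y z : A) (D : set A).

(** Topological closedness in terms of the real norm. *)
Definition mclosed D :=
  forall x, (forall e : R, 0 < e -> exists2 y, D y & nr (x - y) <= e) -> D x.

(** Closed subalgebras need not be self-adjoint here, so that commutants
    qualify. An element that lies in every closed subalgebra containing [a]
    then commutes with whatever commutes with [a]. *)
Record csub D : Prop := CSub {
  csub0 : D 0;
  csubD : forall x y, D x -> D y -> D (x + y);
  csubZ : forall (c : R[i]) x, D x -> D (c *: x);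
  csubM : forall x y, D x -> D y -> D (x ** y);
  csub_closed : mclosed D
}.

Lemma csubN D x : csub D -> D x -> D (- x).
Proof. by move=> cD Dx; rewrite -scaleN1r; apply: csubZ. Qed.
Lemma csubB D x y : csub D -> D x -> D y -> D (x - y).
Proof. by move=> cD Dx Dy; apply: csubD => //; apply: csubN. Qed.

Lemma nr_small K x : (forall e : R, 0 < e -> nr x <= K * e) -> x = 0.
Proof.
move=> xK; apply: nr_le0; apply/ler_addgt0Pr => e e0.
have K0 : 0 <= K by have := xK 1 ltr01; have := nr_ge0 x; lra.
have K1 : 0 < K + 1 by lra.
have := xK (e / (K + 1)); rewrite divr_gt0// => /(_ isT) /le_trans; apply.
rewrite add0r mulrA ler_pdivrMr//; lra.
Qed.

Lemma csub_commutant z : csub [set x | x ** z = z ** x].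
Proof.
constructor => /=.
- by rewrite csmul0l csmul0r.
- by move=> x y xz yz; rewrite csmulDl csmulDr xz yz.
- by move=> c x xz; rewrite csmulZl csmulZr xz.
- by move=> x y xz yz; rewrite -csmulA yz !csmulA xz.
- move=> x xz; apply/subr0_eq/(@nr_small (nr z + nr z)) => e e0.
  have [y /= yz xy] := xz _ e0.
  have -> : x ** z - z ** x = (x - y) ** z - z ** (x - y).
    by rewrite csmulDl csmulDr csmulNl csmulNr yz; lin_coefs; ring.
  have := nrBD ((x - y) ** z) (z ** (x - y)).
  have := nrM (x - y) z; have := nrM z (x - y); have := nr_ge0 z; nra.
Qed.

Lemma mclosed_sa : mclosed [set x | x^# = x].
Proof.
move=> x xz /=; apply/subr0_eq/(@nr_small 2) => e /xz[y /= yz xy].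
have -> : x^# - x = (x - y)^# - (x - y) by rewrite !csE yz; lin_coefs; ring.
by have := nrBD (x - y)^# (x - y); rewrite nrJ; lra.
Qed.
End Closed.

Section Sqrt.
Context {R : realType} {A : cstarType R}.
Implicit Types (x y z : A) (D : set A).

(** The iteration [b := (y + b^2) / 2] for real [y = 1]. It increases to 1 and
    majorises, step by step, the iteration for any [y] of norm at most 1. *)
Fixpoint sqrt_bnd (n : nat) : R :=
  if n is n'.+1 then (1 + sqrt_bnd n' ^+ 2) / 2 else 0.

Fixpoint sqrt_iter y (n : nat) : A :=
  if n is n'.+1 then (2^-1)%:C *: (y + sqrt_iter y n' ** sqrt_iter y n')
  else 0.

Lemma sqrt_bnd_itv n : 0 <= sqrt_bnd n <= 1.
Proof.
elim: n => [|n /= /andP[h0 h1]]; first by rewrite lexx ler01.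
by move: (sqrt_bnd n) h0 h1 => b h0 h1; apply/andP; split; nra.
Qed.

(** The defect [c = 1 - b] satisfies [c' = c - c^2 / 2], hence decays like
    [2 / n]; convergence is slow because [y = 1] is the boundary case. *)
Lemma sqrt_bnd_lim n : 1 - sqrt_bnd n <= 2 / n.+2%:R.
Proof.
elim: n => [|n IH]; first by rewrite subr0 divff ?pnatr_eq0.
move: IH; have /andP[b0 b1] /= := sqrt_bnd_itv n.
rewrite -(natr1 n.+2); set m : R := n.+2%:R.
have m0 : 2 <= m by rewrite ler_nat.
move: (sqrt_bnd n) b0 b1 => c b0 b1; clearbody m.
rewrite !ler_pdivlMr; [|lra|lra] => h; nra.
Qed.

Lemma sqrt_bnd_small (e : R) : 0 < e -> exists n, 1 - sqrt_bnd n < e.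
Proof.
move=> e0; have := archi_boundP (ltW (divr_gt0 (ltr0n R 2) e0)).
set n := Num.bound _ => nP; exists n; apply: le_lt_trans (sqrt_bnd_lim n) _.
rewrite ltr_pdivrMr// mulrC -ltr_pdivrMr// (lt_trans nP)// ltr_nat; lia.
Qed.

Lemma sqrt_iter_bnd y n : nr y <= 1 -> nr (sqrt_iter y n) <= sqrt_bnd n.
Proof.
move=> y1; elim: n => [|n IH] /=; first by rewrite nr0.
rewrite nrZ ger0_norm ?invr_ge0//.
have := nrD y (sqrt_iter y n ** sqrt_iter y n).
have := nrM (sqrt_iter y n) (sqrt_iter y n).
have := nr_ge0 (sqrt_iter y n); nra.
Qed.

(** A difference of squares factors as [v (v - u) + (v - u) u], without any
    commutativity. *)
Lemma sqrt_iter_step y n : nr y <= 1 ->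
  nr (sqrt_iter y n.+1 - sqrt_iter y n) <= sqrt_bnd n.+1 - sqrt_bnd n.
Proof.
move=> y1; elim: n => [|n IH].
  rewrite /= csmul0l addr0 subr0 subr0 expr0n addr0 nrZ ger0_norm ?invr_ge0//.
  by lra.
have s0 := sqrt_iter_bnd n y1; have s1 := sqrt_iter_bnd n.+1 y1.
rewrite [sqrt_iter _ n.+2]/= [X in _ - X]/= [sqrt_bnd n.+2]/=.
rewrite [X in _ <= _ - X]/= -/(sqrt_iter y n.+1) -/(sqrt_bnd n.+1).
set u := sqrt_iter y n in IH s0 *; set v := sqrt_iter y n.+1 in IH s1 *.
set b := sqrt_bnd n in IH s0 *; set c := sqrt_bnd n.+1 in IH s1 *.
have -> : (2^-1)%:C *: (y + v ** v) - (2^-1)%:C *: (y + u ** u) =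
   (2^-1)%:C *: (v ** (v - u) + (v - u) ** u) :> A by cslin.
rewrite nrZ ger0_norm ?invr_ge0//.
have := nrD (v ** (v - u)) ((v - u) ** u).
have := nrM v (v - u); have := nrM (v - u) u.
have := ler_pM (nr_ge0 v) (nr_ge0 (v - u)) s1 IH.
have := ler_pM (nr_ge0 (v - u)) (nr_ge0 u) IH s0.
have cE : c = (1 + b ^+ 2) / 2 by [].
clearbody u v b c; lra.
Qed.

Lemma sqrt_iter_lim y : nr y <= 1 ->
  exists b, forall n, nr (b - sqrt_iter y n) <= 1 - sqrt_bnd n.
Proof.
move=> y1; apply: cs_lim => [n|e /sqrt_bnd_small//|n].
  by case/andP: (sqrt_bnd_itv n).
exact: sqrt_iter_step.
Qed.
End Sqrt.

Section SqrtFix.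
Context {R : realType} {A : cstarType R}.
Implicit Types (x y z : A) (D : set A).

(** In the presence of a unit the equation [y + b b = b + b] says that
    [1 - b] is a square root of [1 - y]; without one, [b] still makes sense. *)
Lemma sqrt_fix y : nr y <= 1 -> exists b,
  [/\ nr b <= 1, y + b ** b = b + b, (y^# = y -> b^# = b),
      (forall D, csub D -> D y -> D b) &
      forall n, nr (b - sqrt_iter y n) <= 1 - @sqrt_bnd R n].
Proof.
move=> y1; have [b bP] := sqrt_iter_lim y1; exists b.
have b1 : nr b <= 1 by have := bP 0%N; rewrite /= !subr0.
have near (e : R) : 0 < e -> exists n, nr (b - sqrt_iter y n) <= e.
  by move=> /sqrt_bnd_small[n nP]; exists n; apply: le_trans (bP n) (ltW nP).
split => //.
- apply/subr0_eq/(@nr_small _ _ 6) => e /sqrt_bnd_small[n nP].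
  have := bP n; have := sqrt_iter_bnd n y1; have := sqrt_iter_step n y1.
  have /andP[_] := sqrt_bnd_itv (R := R) n.+1.
  have /andP[_] := sqrt_bnd_itv (R := R) n.
  set u := sqrt_iter y n; set v := sqrt_iter y n.+1 => bn1 bn2 vu un bu.
  have yE : y = 2%:C *: v - u ** u.
    by rewrite /v /= -/u ?csE; lin_coefs; field.
  have -> : y + b ** b - (b + b) =
     ((b - u) ** b + u ** (b - u)) + (2%:C *: (v - u) - 2%:C *: (b - u)).
    by rewrite yE; cslin.
  apply: le_trans (nrD _ _) _.
  have := nrD ((b - u) ** b) (u ** (b - u)).
  have := nrBD (2%:C *: (v - u)) (2%:C *: (b - u)).
  rewrite !nrZ !ger0_norm//.
  have := ler_pM (nr_ge0 (b - u)) (nr_ge0 b) (lexx _) b1.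
  have := ler_pM (nr_ge0 u) (nr_ge0 (b - u)) (le_trans un bn1) (lexx _).
  have := nrM (b - u) b; have := nrM u (b - u); lra.
- move=> ya; apply: mclosed_sa => e /near[n nP]; exists (sqrt_iter y n) => //=.
  elim: n {nP} => [|n IH] /=; first exact: csadj0.
  by rewrite csadjZr csadjD csadjM ya IH.
- move=> D cD Dy; apply: csub_closed (cD) _ _ => e /near[n nP].
  exists (sqrt_iter y n) => //.
  elim: n {nP} => [|n IH] /=; first exact: csub0.
  by apply: csubZ => //; apply: csubD => //; apply: csubM.
Qed.

(** With [w = x + i y] one has [w^# w = x x + y y], and [x] is the real part
    of [w]. *)
Lemma comm_squares x y : x^# = x -> y^# = y -> x ** y = y ** x ->
  nr x ^+ 2 <= nr (x ** x + y ** y).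
Proof.
move=> xa ya xy; pose w := x + imc R *: y.
have <- : w^# ** w = x ** x + y ** y.
  rewrite /w !csE xa ya xy; lin_coefs; ring: (imcM R).
have -> : x = (2^-1)%:C *: (w + w^#).
  by rewrite /w !csE xa ya; lin_coefs; field.
rewrite nr_adjM nrZ ger0_norm ?invr_ge0//.
have := nrD w w^#; rewrite nrJ.
have := nr_ge0 (w + w^#); have := nr_ge0 w.
move: (nr w) (nr (w + _)) => p q p0 q0 qp.
rewrite ler_pXn2r ?nnegrE//; lra.
Qed.

Lemma nr_sq x : x^# = x -> nr (x ** x) = nr x ^+ 2.
Proof. by move=> xa; rewrite -{1}xa nr_adjM. Qed.
Lemma sq_eq0 x : x^# = x -> x ** x = 0 -> x = 0.
Proof.
move=> xa x0; apply: nr_eq0; apply/eqP; rewrite -sqrf_eq0 -nr_sq//.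
by rewrite x0 nr0.
Qed.
Lemma adjM_eq0 x : x^# ** x = 0 -> x = 0.
Proof.
move=> x0; apply: nr_eq0; apply/eqP.
by rewrite -sqrf_eq0 -nr_adjM x0 nr0.
Qed.
End SqrtFix.

(** * Positivity in a unital C*-algebra *)

Section Unital.
Context {R : realType} {U : cstarType R}.
Implicit Types (x y z a b h s u v w : U) (D : set U).
Variable e : U.
Hypothesis csmul_unitl : forall x, e ** x = x.

Lemma unit_adj : e^# = e.
Proof. by rewrite -[RHS]csadjK -{2}(csmul_unitl e^#) csadjM csadjK csmul_unitl. Qed.
Lemma csmul_unitr x : x ** e = x.
Proof. by rewrite -[LHS]csadjK csadjM unit_adj csmul_unitl csadjK. Qed.
Lemma nr_unit : nr e <= 1.
Proof.
have := nr_adjM e; rewrite unit_adj csmul_unitl => E.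
by rewrite leNgt; apply/negP => e1; have := nr_ge0 e; nra.
Qed.

(** For real numbers, [|l - a| <= l] means [0 <= a <= 2 l]. This form of
    positivity is evidently stable under sums and limits. *)
Definition pos a := a^# = a /\ exists2 l : R, 0 <= l & nr (l%:C *: e - a) <= l.

Lemma pos0 : pos 0.
Proof. by split; [exact: csadj0 | exists 0; rewrite // scale0r subr0 nr0]. Qed.

Lemma posD a b : pos a -> pos b -> pos (a + b).
Proof.
move=> [aa [l l0 la]] [ba [m m0 mb]]; split; first by rewrite csadjD aa ba.
exists (l + m); first exact: addr_ge0.
have -> : (l + m)%:C *: e - (a + b) = (l%:C *: e - a) + (m%:C *: e - b).
  by cslin.
by apply: le_trans (nrD _ _) _; apply: lerD.
Qed.

Lemma posZ (r : R) a : 0 <= r -> pos a -> pos (r%:C *: a).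
Proof.
move=> r0 [aa [l l0 la]]; split; first by rewrite csadjZr aa.
exists (r * l); first exact: mulr_ge0.
have -> : (r * l)%:C *: e - r%:C *: a = r%:C *: (l%:C *: e - a) by cslin.
by rewrite nrZ ger0_norm// ler_wpM2l.
Qed.

Lemma pos_norm_sub a : a^# = a -> pos ((nr a)%:C *: e - a).
Proof.
move=> aa; split; first by rewrite !csE unit_adj aa.
by exists (nr a); [exact: nr_ge0 | rewrite opprB addrC subrK].
Qed.

(** Rescale so that [l = 1]; then [y = e - a] has norm at most 1 and [e - b],
    with [b] from sqrt_fix, is the root. The unit need not belong to a closed
    subalgebra [D] containing [a]; the root does, because its approximants
    [e - sqrt_iter y n] differ from elements of [D] by multiples of [e] that
    tend to 0. *)
Lemma pos_sqrt a : pos a -> exists s,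
  [/\ s^# = s, s ** s = a, pos s & forall D, csub D -> D a -> D s].
Proof.
move=> [aa [l l0 la]]; have [lE|ln] := eqVneq l 0.
  have -> : a = 0.
    by apply: nr_le0; move: la; rewrite lE scale0r sub0r nrN.
  exists 0; split; [exact: csadj0|exact: csmul0l|exact: pos0|by []].
have lp : 0 < l by rewrite lt_neqAle eq_sym ln.
pose y := e - (l^-1)%:C *: a.
have yE : y = (l^-1)%:C *: (l%:C *: e - a) by rewrite /y; cslin_field.
have y1 : nr y <= 1.
  by rewrite yE nrZ ger0_norm ?invr_ge0// mulrC ler_pdivrMr// mul1r.
have ya : y^# = y by rewrite /y !csE unit_adj aa.
have [b [b1 bb ba _ bl]] := sqrt_fix y1; have {}ba := ba ya.
pose r : R := Num.sqrt l.
have rr : r ^+ 2 = l by rewrite sqr_sqrtr.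
have r0 : 0 <= r by exact: sqrtr_ge0.
have bb' : b ** b = b + b - y by rewrite -bb addrC addKr.
exists (r%:C *: (e - b)); split.
- by rewrite !csE unit_adj ba.
- rewrite !csE csmul_unitl csmul_unitl csmul_unitr bb' /y -[in RHS](scale1r a).
  have r1 : r%:C * r%:C * (l^-1)%:C = 1.
    by rewrite -!rmorphM /= -expr2 rr divff.
  by lin_coefs; rewrite -?r1; ring.
- split; first by rewrite !csE unit_adj ba.
  exists r => //; have -> : r%:C *: e - r%:C *: (e - b) = r%:C *: b by cslin.
  by rewrite nrZ ger0_norm// ler_piMr.
- move=> D cD Da; apply: csubZ => //; apply: csub_closed (cD) _ _ => d d0.
  have [n nP] := sqrt_bnd_small (divr_gt0 d0 (ltr0n R 2)).
  exists ((sqrt_bnd n)%:C *: e - sqrt_iter y n).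
    elim: n {nP} => [|n IH] /=; first by rewrite scale0r subr0; exact: csub0.
    set w := (X in D X) in IH; set v := sqrt_iter y n in w IH *.
    set c := sqrt_bnd n in w IH *.
    have vE : v = c%:C *: e - w by rewrite /w; cslin.
    suff -> : ((1 + c ^+ 2) / 2)%:C *: e - (2^-1)%:C *: (y + v ** v) =
        (2^-1)%:C *: ((l^-1)%:C *: a + (2 * c)%:C *: w - w ** w).
      apply: csubZ => //; apply: csubB => //; last exact: csubM.
      by apply: csubD => //; apply: csubZ.
    clearbody w v; rewrite vE /y ?csE !csmul_unitl csmul_unitr.
    by lin_coefs; field; rewrite ?fmorph_eq0.
  have -> : e - b - ((sqrt_bnd n)%:C *: e - sqrt_iter y n) =
     (1 - sqrt_bnd n)%:C *: e - (b - sqrt_iter y n) by cslin.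
  have /andP[_ n1] := sqrt_bnd_itv (R := R) n.
  have := bl n; have := nrBD ((1 - sqrt_bnd n)%:C *: e) (b - sqrt_iter y n).
  rewrite nrZ ger0_norm ?subr_ge0//.
  have := ler_piMr (_ : 0 <= 1 - sqrt_bnd n) nr_unit.
  rewrite subr_ge0 n1 => /(_ isT); lra.
Qed.

(** For [h] of norm 1, sqrt_fix gives a self-adjoint root [e - b] of
    [e - h h] that commutes with [h]. The two squares add up to [e], so
    comm_squares bounds [e - h h] by 1. *)
Lemma pos_sq h : h^# = h -> pos (h ** h).
Proof.
move=> ha; have [h0|hn] := eqVneq (nr h) 0.
  by rewrite (nr_eq0 h0) csmul0l; exact: pos0.
have hp : 0 < nr h by rewrite lt_neqAle eq_sym hn nr_ge0.
split; first by rewrite csadjM ha.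
exists (nr h ^+ 2); first exact: sqr_ge0.
pose k := ((nr h)^-1)%:C *: h.
have ka : k^# = k by rewrite csadjZr ha.
have k1 : nr k = 1 by rewrite nrZ ger0_norm ?invr_ge0 ?nr_ge0// mulVf.
have y1 : nr (k ** k) <= 1 by rewrite nr_sq// k1 expr1n.
have [b [b1 bb ba bD _]] := sqrt_fix y1.
have {}ba : b^# = b by apply: ba; rewrite csadjM ka.
have bk : b ** k = k ** b.
  by have := bD _ (csub_commutant k); apply; rewrite /= csmulA.
have E : (e - b) ** (e - b) = e - k ** k.
  have -> : k ** k = b + b - b ** b by rewrite -bb addrK.
  by rewrite ?csE !csmul_unitl csmul_unitr; lin_coefs; ring.
have eba : (e - b)^# = e - b by rewrite !csE unit_adj ba.
have C : (e - b) ** k = k ** (e - b).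
  by rewrite csmulDl csmulDr csmulNl csmulNr bk csmul_unitl csmul_unitr.
have := comm_squares eba ka C; rewrite E subrK => le1.
have -> : (nr h ^+ 2)%:C *: e - h ** h = (nr h ^+ 2)%:C *: (e - k ** k).
  by rewrite /k; cslin_field.
rewrite nrZ ger0_norm ?sqr_ge0// ler_piMr ?sqr_ge0//.
by rewrite -E nr_sq// (le_trans le1)// nr_unit.
Qed.

(** Roots [s] of [a] and [t] of [- a] commute, and [s s + t t = 0]. *)
Lemma pos_sum0 a b : pos a -> pos b -> a + b = 0 -> a = 0.
Proof.
move=> /pos_sqrt[s [sa ss _ _]] /pos_sqrt[t [ta tt _ tD]] ab.
have bE : b = - a by apply/eqP; rewrite -addr_eq0 addrC ab.
have ts : t ** s = s ** t.
  apply: (tD _ (csub_commutant s)); rewrite /= bE -ss.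
  by rewrite csmulNl csmulNr csmulA.
have := comm_squares sa ta (esym ts); rewrite ss tt ab nr0 => s0.
suff sE : s = 0 by rewrite -ss sE csmul0l.
by apply: nr_eq0; apply/eqP; rewrite -sqrf_eq0 eq_le s0 sqr_ge0.
Qed.

(** Let [a = z^# z], [m = |a|] and [n = m - a], which is twice the negative
    part of [a]. Then [w = z n] satisfies [w^# w = n a n = - g g] for a
    self-adjoint [g], and with [v = w g] both [v^# v] and [v v^#] are negatives
    of squares, whereas [v^# v + v v^#] is half the sum of the squares of the
    self-adjoint elements [p = v + v^#] and [q = i (v - v^#)]. By pos_sum0 all
    these squares vanish, hence [n = 0] and [a = m]. *)
Lemma pos_adjM z : pos (z^# ** z).
Proof.
have [a aE] : exists a, a = z^# ** z by exists (z^# ** z).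
rewrite -aE; have aa : a^# = a by rewrite aE csadjM csadjK.
have [m [ma mm pm mD]] := pos_sqrt (pos_sq aa).
have am : m ** a = a ** m.
  by apply: (mD _ (csub_commutant a)); rewrite /= csmulA.
have [n nE] : exists n, n = m - a by exists (m - a).
have na : n^# = n by rewrite nE !csE ma aa.
have [t [ta tt _ tD]] := pos_sqrt pm.
have tn : t ** n = n ** t.
  by apply: (tD _ (csub_commutant n)); rewrite /= nE !csE am.
have amx x : x ** m ** a = x ** a ** m by rewrite -!csmulA am.
have mmx x : x ** m ** m = x ** a ** a by rewrite -!csmulA mm.
have nan : n ** a ** n = - (m ** n ** n).
  by rewrite nE !csE !(am, amx, mm, mmx); lin_coefs; ring.
have nnn : n ** n ** n = 2%:C *: (m ** n ** n).
  by rewrite nE !csE !(am, amx, mm, mmx); lin_coefs; ring.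
have [g gE] : exists g, g = t ** n by exists (t ** n).
have ga : g^# = g by rewrite gE csadjM na ta tn.
have gg : g ** g = m ** n ** n.
  by rewrite gE -tt !csmulA -(csmulA t n t) -tn !csmulA.
have [w wE] : exists w, w = z ** n by exists (z ** n).
have ww : w^# ** w = - (g ** g).
  by rewrite wE csadjM na !csmulA -(csmulA n z^#) -aE nan gg.
have [v vE] : exists v, v = w ** g by exists (w ** g).
have v1 : v^# ** v = - ((g ** g) ** (g ** g)).
  by rewrite vE csadjM ga !csmulA -(csmulA g w^#) ww; cslin.
have v2 : v ** v^# = - ((w ** w^#) ** (w ** w^#)).
  have -> : (w ** w^#) ** (w ** w^#) = w ** (w^# ** w) ** w^#.
    by rewrite !csmulA.
  by rewrite vE csadjM ga ww; cslin.
pose p := v + v^#; pose q := imc R *: (v - v^#).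
have pa : p^# = p by rewrite /p !csE addrC.
have qa : q^# = q by rewrite /q !csE; lin_coefs; ring.
have gga : (g ** g)^# = g ** g by rewrite csadjM ga.
have wwa : (w ** w^#)^# = w ** w^# by rewrite csadjM csadjK.
have gg0 : g ** g = 0.
  apply: (sq_eq0 gga).
  have P1 := posZ (ler0n R 2) (pos_sq gga).
  have P2 := posD (posZ (ler0n R 2) (pos_sq wwa)) (posD (pos_sq pa) (pos_sq qa)).
  have : 2%:C *: (g ** g ** (g ** g)) = 0.
    apply: (pos_sum0 P1 P2).
    have -> : p ** p + q ** q = 2%:C *: (v^# ** v + v ** v^#).
      rewrite /p /q !csE; lin_coefs; ring: (imcM R).
    by rewrite v1 v2; lin_coefs; ring.
  by move/eqP; rewrite scaler_eq0 fmorph_eq0 pnatr_eq0 => /eqP.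
have n0 : n = 0.
  apply: (sq_eq0 na); apply: sq_eq0; first by rewrite csadjM na.
  by rewrite csmulA nnn -gg gg0 scaler0 csmul0l.
have -> : a = m by apply/esym/subr0_eq; rewrite -nE.
exact: pm.
Qed.

(** With [l] the norm of [u + w], the element
    [l e - u = (l e - (u + w)) + w] is positive. It has a root [r] that
    commutes with a root [s] of [u], and [s s + r r = l e]. *)
Lemma pos_mono u w : pos u -> pos w -> nr u <= nr (u + w).
Proof.
move=> pu pw; have [s [sa ss _ sD]] := pos_sqrt pu.
have va : (u + w)^# = u + w by case: (posD pu pw).
have := posD (pos_norm_sub va) pw.
set l := nr (u + w).
have -> : l%:C *: e - (u + w) + w = l%:C *: e - u by cslin.
move=> /pos_sqrt[r [ra rr _ rD]].
have rs : r ** s = s ** r.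
  apply: (rD _ (csub_commutant s)) => /=.
  by rewrite !csE csmul_unitl csmul_unitr -ss csmulA.
have := comm_squares sa ra (esym rs).
rewrite -(nr_sq sa) ss rr addrC subrK => h; apply: le_trans h _.
have l0 : 0 <= l by exact: nr_ge0.
by rewrite nrZ ger0_norm// ler_piMr// nr_unit.
Qed.

Lemma pos_norm_bound a (l : R) : pos a -> nr a <= l -> nr (l%:C *: e - a) <= l.
Proof.
move=> pa al; have l0 : 0 <= l by apply: le_trans al; exact: nr_ge0.
have sub : pos (l%:C *: e - a).
  have -> : l%:C *: e - a = (l - nr a)%:C *: e + ((nr a)%:C *: e - a) by cslin.
  apply: posD; last by apply: pos_norm_sub; case: pa.
  apply: posZ; first by rewrite subr_ge0.
  split; first exact: unit_adj.
  by exists 1 => //; rewrite scale1r subrr nr0.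
have := pos_mono sub pa; rewrite subrK nrZ ger0_norm// => /le_trans; apply.
by rewrite ler_piMr// nr_unit.
Qed.

(** From [(1 + l) x = (x + a x) + (l x - a x)], where [l x - a x] has norm at
    most [l] times that of [x]. *)
Lemma pos_expansive a x : pos a -> nr x <= nr (x + a ** x).
Proof.
move=> [_ [l l0 la]].
have := nrBD (x + a ** x + (l%:C *: x - a ** x)) (l%:C *: x - a ** x).
have := nrD (x + a ** x) (l%:C *: x - a ** x).
have -> : x + a ** x + (l%:C *: x - a ** x) = (1 + l)%:C *: x by cslin.
have -> : l%:C *: x - a ** x = (l%:C *: e - a) ** x by rewrite !csE csmul_unitl.
have := nrM (l%:C *: e - a) x; rewrite nrZ ger0_norm; last lra.
have := ler_wpM2r (nr_ge0 x) la; lra.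
Qed.

(** This [z] is [a (e + a)^-1], the fixed point of the map [f] below; its
    linear part has norm at most [l / (1 + l)]. Working with [z] rather than
    with the inverse [e - z] makes sense inside subalgebras without unit. *)
Lemma pos_resolvent a : pos a -> exists z,
  [/\ z^# = z, z + a ** z = a, (forall x, nr (x - z ** x) <= nr x) &
      forall D, csub D -> D a -> D z].
Proof.
move=> pa; have [aa [l l0 la]] := pa.
pose t := (1 + l)^-1; have t0 : 0 < t by rewrite invr_gt0; lra.
have tl : t * (1 + l) = 1 by rewrite mulVf//; apply: lt0r_neq0; lra.
pose f x := t%:C *: (a + (l%:C *: e - a) ** x).
pose K := nr a; pose r := t * l.
have K0 : 0 <= K by exact: nr_ge0.
have r0 : 0 <= r by rewrite mulr_ge0// (ltW t0).
have r1 : 1 - r = t by rewrite /r -tl; ring.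
have rl1 : r < 1 by move: r1 t0; lra.
pose b (n : nat) : R := K * (1 - r ^+ n).
have fL x y : nr (f x - f y) <= r * nr (x - y).
  have -> : f x - f y = t%:C *: ((l%:C *: e - a) ** (x - y)) by rewrite /f; cslin.
  rewrite nrZ (ger0_norm (ltW t0)) /r -mulrA ler_wpM2l ?(ltW t0)//.
  by apply: le_trans (nrM _ _) _; rewrite ler_wpM2r ?nr_ge0.
have [z zP] : exists z, forall n, nr (z - iter n f 0) <= K - b n.
  apply: cs_lim => [n|d d0|n].
  - by rewrite /b ler_piMr// lerBlDr lerDl exprn_ge0.
  - have dK : 0 < d / (K + 1) by rewrite divr_gt0//; lra.
    have [n nP] := expr_small r0 rl1 dK; exists n.
    move: nP; rewrite ltr_pdivlMr; last lra.
    have := exprn_ge0 n r0; rewrite /b; lra.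
  - elim: n => [|n IH].
      rewrite /b expr0 expr1 subrr mulr0 !subr0 /= /f csmul0r addr0 nrZ.
      by rewrite (ger0_norm (ltW t0)) r1 mulrC.
    rewrite iterS [X in f X - _]iterS [X in _ - X]iterS.
    apply: le_trans (fL _ _) _; rewrite -iterS.
    have := ler_wpM2l r0 IH; rewrite /b !exprS; lra.
have zE : z = f z.
  apply/subr0_eq/(@nr_small _ _ (1 + r)) => d d0.
  have dK : 0 < d / (K + 1) by rewrite divr_gt0//; lra.
  have [n nP] := expr_small r0 rl1 dK.
  have := zP n.+1; have := zP n; rewrite iterS.
  set u := iter n f 0 => zu zfu.
  have := nr_tri (f u) z (f z); have := fL u z; rewrite (nrB u z).
  move: nP; rewrite ltr_pdivlMr; last lra.
  have := exprn_ge0 n r0; have := nr_ge0 (z - u).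
  move: zu zfu; rewrite /b exprS.
  nra.
have zz : z + a ** z = a.
  have : (1 + l)%:C *: z = a + (l%:C *: e - a) ** z.
    by rewrite {1}zE /f scalerA -rmorphM mulrC tl scale1r.
  rewrite !csE csmul_unitl => E.
  have -> : a = a + (l%:C *: z - a ** z) - (l%:C *: z - a ** z).
    by rewrite addrK.
  by rewrite -{2}E; cslin.
have za : z^# = z.
  have zz' : z^# + z^# ** a = a by have := congr1 csadj zz; rewrite csadjD csadjM aa.
  have E : z^# ** a = a ** z.
    transitivity (z^# ** (z + a ** z)); first by rewrite zz.
    by rewrite csmulDr csmulA -csmulDl zz'.
  apply: (addIr (a ** z)); by rewrite zz -E.
exists z; split => // [x|D cD Da].
  apply: le_trans (pos_expansive _ pa) _; rewrite le_eqVlt; apply/orP; left.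
  apply/eqP; congr nr.
  have -> : x - z ** x + a ** (x - z ** x) =
     x + a ** x - (z + a ** z) ** x by cslin.
  by rewrite zz addrK.
apply: csub_closed (cD) _ _ => d d0.
have dK : 0 < d / (K + 1) by rewrite divr_gt0//; lra.
have [n nP] := expr_small r0 rl1 dK.
exists (iter n f 0).
  elim: n {nP} => [|n IH]; first exact: csub0.
  rewrite iterS /f !csE csmul_unitl; apply: csubZ => //; apply: csubD => //.
  by apply: csubB => //; [apply: csubZ|apply: csubM].
apply: le_trans (zP n) _; move: nP; rewrite ltr_pdivlMr; last lra.
have := exprn_ge0 n r0; rewrite /b; lra.
Qed.
End Unital.

(** * The multiplier algebra *)

Section Multiplier.
Context {R : realType} {A : cstarType R}.

(** An adjointable operator on [A], regarded as a Hilbert module over itself;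
    linearity follows from the existence of the adjoint. *)
Record mult := Mult {
  mop :> A -> A;
  mad : A -> A;
  madP : forall x y, (mop x)^# ** y = x^# ** mad y;
  mop_bd : exists K : R, forall x, nr (mop x) <= K * nr x
}.
Implicit Types (S T : mult) (x y : A).

Lemma faithful x y : (forall w, x^# ** w = y^# ** w) -> x = y.
Proof.
move=> h; apply/subr0_eq/adjM_eq0; rewrite csadjD csadjN csmulDl csmulNl h.
exact: subrr.
Qed.

Lemma mopP T x y : (mad T x)^# ** y = x^# ** T y.
Proof. by rewrite -[LHS]csadjK csadjM csadjK -madP csadjM csadjK. Qed.

Lemma mad_bd T : exists K : R, forall x, nr (mad T x) <= K * nr x.
Proof.
have [K TK] := mop_bd T; exists (`|K|) => x.
have [x0|xn] := eqVneq (nr (mad T x)) 0.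
  by rewrite x0 mulr_ge0// nr_ge0.
have xp : 0 < nr (mad T x) by rewrite lt_neqAle eq_sym xn nr_ge0.
rewrite -(ler_pM2r xp) -expr2 -nr_adjM mopP.
apply: le_trans (nrM _ _) _; rewrite nrJ mulrAC mulrC ler_wpM2r ?nr_ge0//.
by apply: le_trans (TK _) _; rewrite ler_wpM2r ?nr_ge0// ler_norm.
Qed.

Lemma multP S T : (forall x, S x = T x) -> S = T.
Proof.
case: S T => [S S' SP Sb] [T T' TP Tb] /= ST.
have {}ST : S = T by apply: funext.
have ST' : S' = T'.
  apply: funext => x; apply: faithful => w.
  apply: (inv_inj csadjK); rewrite !csadjM !csadjK.
  by rewrite -SP -TP ST.
by subst; congr Mult; apply: Prop_irrelevance.
Qed.

Lemma mopD T x y : T (x + y) = T x + T y.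
Proof. by apply: faithful => w; rewrite csadjD csmulDl !madP csadjD csmulDl. Qed.
Lemma mopZ T (c : R[i]) x : T (c *: x) = c *: T x.
Proof. by apply: faithful => w; rewrite csadjZ csmulZl !madP csadjZ csmulZl. Qed.
Fact m0P x y : (0 : A)^# ** y = x^# ** 0.
Proof. by rewrite csadj0 csmul0l csmul0r. Qed.
Fact m0bd : exists K : R, forall x, nr (0 : A) <= K * nr x.
Proof. by exists 0 => x; rewrite nr0 mul0r. Qed.
Definition mzero := Mult m0P m0bd.

Fact maddP S T x y : (S x + T x)^# ** y = x^# ** (mad S y + mad T y).
Proof. by rewrite csadjD csmulDl csmulDr !madP. Qed.
Fact maddbd S T : exists K : R, forall x, nr (S x + T x) <= K * nr x.
Proof.
have [K SK] := mop_bd S; have [L TL] := mop_bd T; exists (K + L) => x.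
by rewrite mulrDl (le_trans (nrD _ _))// lerD.
Qed.
Definition madd S T := Mult (maddP S T) (maddbd S T).

Fact mscaleP (c : R[i]) T x y : (c *: T x)^# ** y = x^# ** (c^* *: mad T y).
Proof. by rewrite csadjZ csmulZl csmulZr madP. Qed.
Fact mscalebd (c : R[i]) T : exists K : R, forall x, nr (c *: T x) <= K * nr x.
Proof.
have [K TK] := mop_bd T; exists (complex.Re `|c| * K) => x.
by rewrite nrZc -mulrA ler_wpM2l// Renorm_ge0.
Qed.
Definition mscale c T := Mult (mscaleP c T) (mscalebd c T).
Definition mopp T := mscale (-1) T.

Fact mcompP S T x y : (S (T x))^# ** y = x^# ** mad T (mad S y).
Proof. by rewrite !madP. Qed.
Fact mcompbd S T : exists K : R, forall x, nr (S (T x)) <= K * nr x.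
Proof.
have [K SK] := mop_bd S; have [L TL] := mop_bd T; exists (`|K| * L) => x.
apply: le_trans (SK _) _; rewrite -mulrA.
apply: le_trans (ler_wpM2r (nr_ge0 _) (ler_norm K)) _.
by rewrite ler_wpM2l.
Qed.
Definition mcomp S T := Mult (mcompP S T) (mcompbd S T).
Definition madj T := Mult (mopP T) (mad_bd T).

HB.instance Definition _ := gen_eqMixin mult.
HB.instance Definition _ := gen_choiceMixin mult.

Fact maddA : associative madd.
Proof. by move=> a b c; apply: multP => x /=; rewrite addrA. Qed.
Fact maddC : commutative madd.
Proof. by move=> a b; apply: multP => x /=; rewrite addrC. Qed.
Fact madd0 : left_id mzero madd.
Proof. by move=> a; apply: multP => x /=; rewrite add0r. Qed.
Fact maddN : left_inverse mzero mopp madd.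
Proof. by move=> a; apply: multP => x /=; rewrite scaleN1r addNr. Qed.
HB.instance Definition _ :=
  GRing.isZmodule.Build mult maddA maddC madd0 maddN.

Fact mscaleA c d a : mscale c (mscale d a) = mscale (c * d) a.
Proof. by apply: multP => x /=; rewrite scalerA. Qed.
Fact mscale1 : left_id 1 mscale.
Proof. by move=> a; apply: multP => x /=; rewrite scale1r. Qed.
Fact mscaleDr : right_distributive mscale +%R.
Proof. by move=> c a b; apply: multP => x /=; rewrite scalerDr. Qed.
Fact mscaleDl a : {morph mscale^~ a : c d / c + d}.
Proof. by move=> c d; apply: multP => x /=; rewrite scalerDl. Qed.
HB.instance Definition _ := GRing.Zmodule_isLmodule.Build R[i] mult
  mscaleA mscale1 mscaleDr mscaleDl.

Lemma multDE S T x : (S + T) x = S x + T x. Proof. by []. Qed.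
Lemma multZE (c : R[i]) T x : (c *: T) x = c *: T x. Proof. by []. Qed.
Lemma multNE T x : (- T) x = - T x. Proof. exact: scaleN1r. Qed.
Lemma multBE S T x : (S - T) x = S x - T x.
Proof. by rewrite multDE multNE. Qed.

Definition mbounds T := [set K : R | 0 <= K /\ forall x, nr (T x) <= K * nr x].
Definition mnorm T : R := inf (mbounds T).

Lemma mbounds_nonempty T : mbounds T !=set0.
Proof.
have [K TK] := mop_bd T; exists (`|K|); split => // x.
by apply: le_trans (TK x) _; rewrite ler_wpM2r ?nr_ge0 ?ler_norm.
Qed.

Lemma mnorm_ge0 T : 0 <= mnorm T.
Proof. by apply: lb_le_inf => [|K []//]; exact: mbounds_nonempty. Qed.

Lemma mnorm_le T (K : R) : 0 <= K -> (forall x, nr (T x) <= K * nr x) ->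
  mnorm T <= K.
Proof. by move=> K0 TK; apply: ge_inf; [exists 0 => L []|split]. Qed.

Lemma mnormP T x : nr (T x) <= mnorm T * nr x.
Proof.
have [x0|xn] := eqVneq (nr x) 0.
  have [K TK] := mop_bd T; have := TK x.
  by rewrite x0 !mulr0.
have xp : 0 < nr x by rewrite lt_neqAle eq_sym xn nr_ge0.
rewrite -ler_pdivrMr//; apply: lb_le_inf; first exact: mbounds_nonempty.
by move=> K [_ TK]; rewrite ler_pdivrMr.
Qed.

Fact mnormD S T : (mnorm (S + T))%:C <= (mnorm S)%:C + (mnorm T)%:C.
Proof.
rewrite -rmorphD lecR; apply: mnorm_le => [|x].
  by rewrite addr_ge0 ?mnorm_ge0.
by rewrite multDE mulrDl (le_trans (nrD _ _))// lerD// mnormP.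
Qed.

Fact mnormZ (c : R[i]) T : (mnorm (c *: T))%:C = `|c| * (mnorm T)%:C.
Proof.
rewrite -[`|c|]normCre -rmorphM; congr real_complex_def.
set r := complex.Re `|c|; have r0 : 0 <= r by exact: Renorm_ge0.
apply: le_anti; apply/andP; split.
  apply: mnorm_le => [|x]; first by rewrite mulr_ge0 ?mnorm_ge0.
  by rewrite multZE nrZc -mulrA ler_wpM2l ?mnormP.
have [rE|rn] := eqVneq r 0; first by rewrite rE mul0r mnorm_ge0.
have rp : 0 < r by rewrite lt_neqAle eq_sym rn.
rewrite mulrC -ler_pdivlMr//; apply: mnorm_le => [|x].
  by rewrite divr_ge0 ?mnorm_ge0.
by rewrite mulrAC ler_pdivlMr// mulrC -nrZc -multZE mnormP.
Qed.

Fact mnorm_eq0 T : (mnorm T)%:C = 0 -> T = 0.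
Proof.
move=> /complexI T0; apply: multP => x; apply: nr_le0.
by have := mnormP T x; rewrite T0 mul0r.
Qed.

HB.instance Definition _ := Lmodule_isNormed.Build R[i] mult
  mnormD mnormZ mnorm_eq0.

Lemma multnE T : `|T| = (mnorm T)%:C. Proof. by []. Qed.

Fact mult_complete (F : set_system mult) : ProperFilter F -> cauchy F -> cvg F.
Proof.
move=> FF /cauchyP Fc.
have Fe (e : R) : 0 < e -> exists T, F [set S | mnorm (T - S) <= e].
  move=> e0; have ec0 : 0 < e%:C :> R[i] by rewrite ltcR.
  have [T FT] := Fc _ ec0; exists T; apply: filterS FT => S.
  by rewrite -ball_normE /= multnE ltcR => /ltW.
have near_ex (e : R) x T : F [set S | mnorm (T - S) <= e] ->
    F [set S : mult | nr (T x - S x) <= e * nr x].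
  apply: filterS => S /= h; rewrite -multBE; apply: le_trans (mnormP _ _) _.
  by rewrite ler_wpM2r ?nr_ge0.
(* To be applied to the operators and to their adjoints, pointwise. *)
have limx (f : mult -> A) :
    (forall e : R, 0 < e -> exists y, F [set S | nr (y - f S) <= e]) ->
    exists l, forall e : R, 0 < e -> F [set S | nr (l - f S) <= e].
  move=> fc; have /cvg_ex[l fl] : cvg (f @ F).
    apply: cauchy_cvg; apply: cauchy_exP => e /posCre[d d0 ->].
    have [y Fy] := fc _ (divr_gt0 d0 (ltr0n R 2)); exists y.
    change (F (f @^-1` ball y d%:C)); apply: filterS Fy => S /=.
    by rewrite -ball_normE /= -nrE ltcR => h; lra.
  exists l => e e0; have ec0 : 0 < e%:C :> R[i] by rewrite ltcR.
  have : F (f @^-1` ball l e%:C) by exact: (fl _ (nbhsx_ballx l _ ec0)).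
  by apply: filterS => S; rewrite /= -ball_normE /= -nrE ltcR => /ltW.
have small (e : R) x : 0 < e -> exists2 d : R, 0 < d & d * nr x <= e.
  move=> e0; exists (e / (nr x + 1)).
    by rewrite divr_gt0// ltr_wpDl// nr_ge0.
  rewrite mulrAC ler_pdivrMr; last by rewrite ltr_wpDl// nr_ge0.
  by rewrite ler_wpM2l ?(ltW e0)// lerDl.
have mnorm_adj T : forall x, nr (mad T x) <= mnorm T * nr x.
  move=> x; have [x0|xn] := eqVneq (nr (mad T x)) 0.
    by rewrite x0 mulr_ge0 ?mnorm_ge0 ?nr_ge0.
  have xp : 0 < nr (mad T x) by rewrite lt_neqAle eq_sym xn nr_ge0.
  rewrite -(ler_pM2r xp) -expr2 -nr_adjM mopP.
  apply: le_trans (nrM _ _) _; rewrite nrJ mulrAC mulrC ler_wpM2r ?nr_ge0//.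
  exact: mnormP.
have /choice[l lP] : forall x, exists l, forall e : R, 0 < e ->
    F [set S : mult | nr (l - S x) <= e].
  move=> x; apply: limx => e /(small _ x)[d /Fe[T FT] de]; exists (T x).
  by apply: filterS (near_ex _ x _ FT) => S /= /le_trans; apply.
have /choice[k kP] : forall x, exists l, forall e : R, 0 < e ->
    F [set S : mult | nr (l - mad S x) <= e].
  move=> x; apply: limx => e /(small _ x)[d /Fe[T FT] de]; exists (mad T x).
  apply: filterS FT => S /= h; apply: le_trans de.
  have -> : mad T x - mad S x = mad (T - S) x.
    change (mad T x - mad S x = mad T x + (-1 : R[i])^* *: mad S x).
    by rewrite rmorphN rmorph1 scaleN1r.
  by apply: le_trans (mnorm_adj _ _) _; rewrite ler_wpM2r ?nr_ge0.
have lkP x y : (l x)^# ** y = x^# ** k y.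
  apply/subr0_eq/(@nr_small _ _ (nr y + nr x)) => e e0.
  have [S [/= Sl Sk]] := filter_ex (filterI (lP x e e0) (kP y e e0)).
  have -> : (l x)^# ** y - x^# ** k y =
      (l x - S x)^# ** y - x^# ** (k y - mad S y).
    have := madP S x y; rewrite !csE => ->; lin_coefs; ring.
  have := nrBD ((l x - S x)^# ** y) (x^# ** (k y - mad S y)).
  have := nrM (l x - S x)^# y; have := nrM x^# (k y - mad S y).
  rewrite !nrJ.
  have := ler_wpM2r (nr_ge0 y) Sl; have := ler_wpM2l (nr_ge0 x) Sk; lra.
have near_l (e : R) x T : 0 < e -> F [set S | mnorm (T - S) <= e] ->
    nr (T x - l x) <= e * nr x.
  move=> e0 FT; apply/ler_addgt0Pr => h h0.
  have [S [/= Sl Sk]] := filter_ex (filterI (near_ex e x T FT) (lP x h h0)).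
  by have := nr_tri (S x) (T x) (l x); rewrite (nrB (S x)); lra.
have lbd : exists K : R, forall x, nr (l x) <= K * nr x.
  have [T FT] := Fe 1 ltr01; exists (mnorm T + 1) => x.
  have := near_l _ x T ltr01 FT; have := mnormP T x.
  by have := nr_tri (T x) 0 (l x); rewrite !sub0r !nrN; lra.
apply/cvg_ex; exists (Mult lkP lbd); apply/cvg_ballP => e /posCre[d d0 ->].
have d30 : 0 < d / 3 by rewrite divr_gt0.
have [T FT] := Fe _ d30; apply: filterS (FT) => S /= TS.
rewrite -ball_normE /= multnE ltcR.
have lT : mnorm (T - Mult lkP lbd) <= d / 3.
  by apply: mnorm_le => [|x]; [exact: ltW|rewrite multBE /=; exact: near_l].
have : mnorm (Mult lkP lbd - S) <= mnorm (T - S) + mnorm (T - Mult lkP lbd).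
  have := ler_normD (Mult lkP lbd - T) (T - S).
  by rewrite subrKA (distrC _ T) !multnE -rmorphD lecR [leRHS]addrC.
lra.
Qed.
HB.instance Definition _ := Uniform_isComplete.Build mult mult_complete.

Fact mcompA : associative mcomp.
Proof. by move=> a b c; apply: multP. Qed.
Fact mcompDl : left_distributive mcomp +%R.
Proof. by move=> a b c; apply: multP. Qed.
Fact mcompDr : right_distributive mcomp +%R.
Proof. by move=> a b c; apply: multP => x /=; rewrite mopD. Qed.
Fact mcompZl (c : R[i]) a b : mcomp (c *: a) b = c *: mcomp a b.
Proof. by apply: multP. Qed.
Fact mcompZr (c : R[i]) a b : mcomp a (c *: b) = c *: mcomp a b.
Proof. by apply: multP => x /=; rewrite mopZ. Qed.
Fact mnormM a b : `|mcomp a b| <= `|a| * `|b|.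
Proof.
rewrite !multnE -rmorphM lecR; apply: mnorm_le => [|x].
  by rewrite mulr_ge0 ?mnorm_ge0.
rewrite -mulrA; apply: le_trans (mnormP a (b x)) _.
by rewrite ler_wpM2l ?mnorm_ge0 ?mnormP.
Qed.
Fact madjK : involutive madj.
Proof. by move=> a; apply: multP. Qed.
Fact madjD : {morph madj : a b / a + b}.
Proof. by move=> a b; apply: multP. Qed.
Fact madjZ (c : R[i]) a : madj (c *: a) = c^* *: madj a.
Proof. by apply: multP. Qed.
Fact madjM a b : madj (mcomp a b) = mcomp (madj b) (madj a).
Proof. by apply: multP. Qed.
Fact mnorm_adj a : `|mcomp (madj a) a| = `|a| ^+ 2.
Proof.
have sq b : mnorm b ^+ 2 <= mnorm (mcomp (madj b) b).
  have c0 : 0 <= mnorm (mcomp (madj b) b) by exact: mnorm_ge0.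
  rewrite -(sqr_sqrtr c0) ler_pXn2r ?nnegrE ?mnorm_ge0 ?sqrtr_ge0//.
  apply: mnorm_le => [|x]; first exact: sqrtr_ge0.
  rewrite -(ler_pXn2r (isT : (0 < 2)%N)) ?nnegrE ?nr_ge0//; last first.
    by rewrite mulr_ge0 ?nr_ge0 ?sqrtr_ge0.
  rewrite exprMn sqr_sqrtr// -nr_adjM madP expr2 mulrA mulrC.
  apply: le_trans (nrM _ _) _; rewrite nrJ ler_wpM2l ?nr_ge0//.
  exact: (mnormP (mcomp (madj b) b)).
have adjle b : mnorm b <= mnorm (madj b).
  have := sq b; have := mnormM (madj b) b.
  rewrite !multnE -rmorphM lecR => h1 h2.
  have [b0|bn] := eqVneq (mnorm b) 0; first by rewrite b0 mnorm_ge0.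
  have bp : 0 < mnorm b by rewrite lt_neqAle eq_sym bn mnorm_ge0.
  by rewrite -(ler_pM2r bp) -expr2 (le_trans h2).
rewrite !multnE -rmorphXn; congr real_complex_def.
apply: le_anti; rewrite sq andbT -lecR -multnE.
apply: le_trans (mnormM _ _) _; rewrite !multnE -rmorphM lecR expr2.
by rewrite ler_wpM2r ?mnorm_ge0// (le_trans (adjle _))// madjK.
Qed.

HB.instance Definition _ := isCStarAlgebra.Build R mult
  mcompA mcompDl mcompDr mcompZl mcompZr mnormM
  madjK madjD madjZ madjM mnorm_adj.

Fact mid_P x y : x^# ** y = x^# ** y. Proof. by []. Qed.
Fact mid_bd : exists K : R, forall x, nr x <= K * nr x.
Proof. by exists 1 => x; rewrite mul1r. Qed.
Definition mid := Mult mid_P mid_bd.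
Lemma mid_unit (T : (mult : cstarType R)) : (mid : (mult : cstarType R)) ** T = T.
Proof. by apply: multP. Qed.

Fact mleftP a x y : (a ** x)^# ** y = x^# ** (a^# ** y).
Proof. by rewrite csadjM csmulA. Qed.
Fact mleft_bd a : exists K : R, forall x, nr (a ** x) <= K * nr x.
Proof. by exists (nr a) => x; exact: nrM. Qed.
(** [A] acts on itself by left multiplication. This isometric embedding into
    an algebra with unit is what the multiplier algebra is for. *)
Definition mleft a : (mult : cstarType R) := Mult (mleftP a) (mleft_bd a).

Lemma mleft_hom : star_hom mleft.
Proof.
split.
- by move=> c x y; apply: multP => w /=; rewrite csmulDl csmulZl.
- by move=> x y; apply: multP => w /=; rewrite csmulA.
- by move=> x; apply: multP.
Qed.

Lemma nr_mleft a : nr (mleft a) = nr a.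
Proof.
apply: le_anti; apply/andP; split.
  by apply: mnorm_le => [|x]; [exact: nr_ge0|exact: nrM].
have [a0|an] := eqVneq (nr a) 0; first by rewrite a0 nr_ge0.
have ap : 0 < nr a by rewrite lt_neqAle eq_sym an nr_ge0.
rewrite -(ler_pM2r ap) -expr2 -[in leLHS](nrJ a) -nr_adjM csadjK.
by rewrite -[in leRHS](nrJ a); exact: (mnormP (mleft a) a^#).
Qed.
End Multiplier.

(** * Homomorphisms, and positivity without a unit *)

Section StarHom.
Context {R : realType} {A B : cstarType R} (f : A -> B).
Hypothesis fh : star_hom f.

Lemma homD x y : f (x + y) = f x + f y.
Proof. by case: fh => l _ _; have := l 1 x y; rewrite !scale1r. Qed.
Lemma hom0 : f 0 = 0.
Proof. by apply: (addrI (f 0)); rewrite -homD !addr0. Qed.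
Lemma homZ (c : R[i]) x : f (c *: x) = c *: f x.
Proof. by case: fh => l _ _; have := l c x 0; rewrite hom0 !addr0. Qed.
Lemma homN x : f (- x) = - f x.
Proof. by rewrite -scaleN1r homZ scaleN1r. Qed.
Lemma homB x y : f (x - y) = f x - f y.
Proof. by rewrite homD homN. Qed.
Lemma homM x y : f (x ** y) = f x ** f y.
Proof. by case: fh => _ m _; exact: m. Qed.
Lemma homJ x : f x^# = (f x)^#.
Proof. by case: fh => _ _ j; exact: j. Qed.
Lemma hom_sum (I : Type) (s : seq I) (F : I -> A) :
  f (\sum_(i <- s) F i) = \sum_(i <- s) f (F i).
Proof.
by elim: s => [|i s IH]; rewrite ?big_nil ?hom0// !big_cons homD IH.
Qed.
End StarHom.

Section Positive.
Context {R : realType} {A : cstarType R}.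
Implicit Types (a b x y z : A) (D : set A).

Local Notation M := (@mult R A : cstarType R).
Local Notation e := (@mid R A : M).
Local Notation iota := (@mleft R A).
Let iH := @mleft_hom R A.

Lemma mleft_inj : injective iota.
Proof.
move=> x y xy; apply/subr0_eq/nr_eq0.
by rewrite -nr_mleft (homB iH) xy subrr nr0.
Qed.

(** The embedding is isometric, so images of closed sets are closed. Hence the
    roots and resolvents formed in the multiplier algebra belong to [A]. *)
Lemma csub_mleft D : csub D -> csub (iota @` D).
Proof.
move=> cD; constructor.
- by exists 0; [exact: csub0|rewrite (hom0 iH)].
- by move=> _ _ [x Dx <-] [y Dy <-]; exists (x + y); [exact: csubD|rewrite (homD iH)].
- by move=> c _ [x Dx <-]; exists (c *: x); [exact: csubZ|rewrite (homZ iH)].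
- by move=> _ _ [x Dx <-] [y Dy <-]; exists (x ** y); [exact: csubM|rewrite (homM iH)].
move=> x xD; pose q n : R := 2^-1 ^+ n.
have q0 n : 0 < q n by rewrite exprn_gt0// invr_gt0.
have qs (d : R) : 0 < d -> exists n, q n < d by apply: expr_small; lra.
have /choice[d dP] : forall n, exists y, D y /\ nr (x - iota y) <= q n.
  by move=> n; have [_ [y Dy <-] h] := xD _ (q0 n); exists y.
have [l lP] : exists l, forall n, nr (l - d n) <= 0 - (- 3 * q n).
  apply: cs_lim => [n|r r0|n].
  - by have := q0 n; lra.
  - have [n nr] := qs (r / 3) (divr_gt0 r0 (ltr0n R 3)); exists n; lra.
  - rewrite -nr_mleft (homB iH).
    have := nr_tri x (iota (d n.+1)) (iota (d n)).
    have := (dP n).2; have := (dP n.+1).2.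
    rewrite (nrB x (iota (d n.+1))) /q exprS; lra.
exists l.
  apply: csub_closed (cD) _ _ => r r0.
  have [n nr] := qs (r / 3) (divr_gt0 r0 (ltr0n R 3)); exists (d n).
    exact: (dP n).1.
  by have := lP n; lra.
apply/subr0_eq/(@nr_small _ _ 4) => r /qs[n nr].
have := nr_tri (iota (d n)) (iota l) x; rewrite -(homB iH) nr_mleft.
by have := (dP n).2; have := lP n; rewrite (nrB x); lra.
Qed.

Lemma csub_setT : csub [set: A]. Proof. by []. Qed.

Definition cpos a := pos e (iota a).

Lemma cpos_sa a : cpos a -> a^# = a.
Proof. by case=> h _; apply: mleft_inj; rewrite (homJ iH). Qed.

Lemma cposD a b : cpos a -> cpos b -> cpos (a + b).
Proof. by move=> pa pb; rewrite /cpos (homD iH); apply: posD. Qed.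

Lemma cposZ (r : R) a : 0 <= r -> cpos a -> cpos (r%:C *: a).
Proof. by move=> r0 pa; rewrite /cpos (homZ iH); apply: posZ. Qed.

Lemma cpos0 : cpos 0.
Proof. by rewrite /cpos (hom0 iH); apply: pos0. Qed.

Lemma cpos_adjM z : cpos (z^# ** z).
Proof. by rewrite /cpos (homM iH) (homJ iH); apply: pos_adjM mid_unit _. Qed.

Lemma cpos_sq z : z^# = z -> cpos (z ** z).
Proof. by move=> za; rewrite -{1}za; apply: cpos_adjM. Qed.

Lemma cpos_mono a b : cpos a -> cpos b -> nr a <= nr (a + b).
Proof.
move=> pa pb; rewrite -nr_mleft -(nr_mleft (a + b)) (homD iH).
by apply: pos_mono pa pb; exact: mid_unit.
Qed.

Lemma cpos_sum0 a b : cpos a -> cpos b -> a + b = 0 -> a = 0.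
Proof.
move=> pa pb ab; apply: nr_le0; have := cpos_mono pa pb.
by rewrite ab nr0.
Qed.

Lemma cpos_sqrt a : cpos a -> exists s,
  [/\ s^# = s, s ** s = a, cpos s & forall D, csub D -> D a -> D s].
Proof.
move=> /(pos_sqrt mid_unit)[S [Sa SS pS SD]].
have [|s _ sE] := SD _ (csub_mleft csub_setT); first by exists a.
exists s; split.
- by apply: mleft_inj; rewrite (homJ iH) sE.
- by apply: mleft_inj; rewrite (homM iH) sE.
- by rewrite /cpos sE.
move=> D cD Da; have [|t Dt tE] := SD _ (csub_mleft cD); first by exists a.
by rewrite (_ : s = t)//; apply: mleft_inj; rewrite sE tE.
Qed.

Lemma cpos_conj a x : cpos a -> cpos (x^# ** a ** x).
Proof.
move=> /cpos_sqrt[s [sa <- _ _]].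
have -> : x^# ** (s ** s) ** x = (s ** x)^# ** (s ** x).
  by rewrite csadjM sa !csmulA.
exact: cpos_adjM.
Qed.

Lemma cpos_resolvent a : cpos a -> exists z,
  [/\ z^# = z, z + a ** z = a, (forall x, nr (x - z ** x) <= nr x) &
      forall D, csub D -> D a -> D z].
Proof.
move=> /(pos_resolvent mid_unit)[Z [Za ZZ Zc ZD]].
have [|z _ zE] := ZD _ (csub_mleft csub_setT); first by exists a.
exists z; split.
- by apply: mleft_inj; rewrite (homJ iH) zE.
- by apply: mleft_inj; rewrite (homD iH) (homM iH) zE.
- by move=> x; have := Zc (iota x); rewrite -zE -(homM iH) -(homB iH) !nr_mleft.
move=> D cD Da; have [|t Dt tE] := ZD _ (csub_mleft cD); first by exists a.
by rewrite (_ : z = t)//; apply: mleft_inj; rewrite zE tE.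
Qed.

Lemma cpos_expansive a x : cpos a -> nr x <= nr (x + a ** x).
Proof.
move=> pa; have := pos_expansive mid_unit (iota x) pa.
by rewrite -(homM iH) -(homD iH) !nr_mleft.
Qed.

Lemma cpos_closed : mclosed [set a : A | cpos a].
Proof.
move=> a aP; have aa : a^# = a.
  by apply: mclosed_sa => r /aP[b /cpos_sa bb ab]; exists b.
split; first by rewrite -(homJ iH) aa.
exists (nr a + 1); first by rewrite addr_ge0 ?nr_ge0.
apply/ler_addgt0Pr => r r0.
have m0 : 0 < Num.min r 1 by rewrite lt_min r0 ltr01.
have [b /= pb] := aP _ m0; rewrite le_min => /andP[ab ab1].
have bl : nr (iota b) <= nr a + 1.
  by have := nr_tri a b 0; rewrite !subr0 (nrB b) nr_mleft; lra.
have := pos_norm_bound mid_unit pb bl; set l := nr a + 1 => lb.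
have := nr_tri (l%:C *: e - iota b) (l%:C *: e - iota a) 0.
rewrite !subr0.
have -> : l%:C *: e - iota a - (l%:C *: e - iota b) = - iota (a - b).
  by rewrite (homB iH); lin_coefs; ring.
by rewrite nrN nr_mleft; lra.
Qed.

(** Put [d = a - b]. Then [d a d + d b d = d (a + b) d = 0], so both positive
    terms vanish and [d d d] is their difference. *)
Lemma sqrt_uniq a b : cpos a -> cpos b -> a ** b = b ** a ->
  a ** a = b ** b -> a = b.
Proof.
move=> pa pb ab aabb; have aa := cpos_sa pa; have ba := cpos_sa pb.
have [d dE] : exists d, d = a - b by exists (a - b).
have da : d^# = d by rewrite dE !csE aa ba.
have dad : cpos (d ** a ** d) by rewrite -{1}da; exact: cpos_conj.
have dbd : cpos (d ** b ** d) by rewrite -{1}da; exact: cpos_conj.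
have s0 : d ** a ** d + d ** b ** d = 0.
  rewrite -csmulDl -csmulDr.
  have -> : d ** (a + b) = 0.
    by rewrite dE !csE aabb ab; lin_coefs; ring.
  exact: csmul0l.
have d1 := cpos_sum0 dad dbd s0.
have d2 : d ** b ** d = 0 by rewrite -s0 d1 add0r.
have ddd : d ** d ** d = 0.
  have -> : d ** d ** d = d ** a ** d - d ** b ** d.
    by rewrite {2}dE csmulDr csmulNr csmulDl csmulNl.
  by rewrite d1 d2 subrr.
apply/subr0_eq; rewrite -dE; apply: (sq_eq0 da).
by apply: sq_eq0; rewrite ?csadjM ?da// csmulA ddd csmul0l.
Qed.
End Positive.

Section Contractive.
Context {R : realType} {A B : cstarType R} (f : A -> B).
Hypothesis fh : star_hom f.

Lemma hom_cpos a : cpos a -> cpos (f a).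
Proof.
move=> /cpos_sqrt[s [sa <- _ _]]; rewrite (homM fh).
by apply: cpos_sq; rewrite -(homJ fh) sa.
Qed.

(** A homomorphism preserves the equation that exhibits [h h] and a square as
    adding up to the unit, and comm_squares reads off the bound. *)
Lemma hom_sa_contr h : h^# = h -> nr h <= 1 -> nr (f h) <= 1.
Proof.
move=> ha h1; have y1 : nr (h ** h) <= 1 by rewrite nr_sq// expr_le1// nr_ge0.
have [b [b1 bb ba bD _]] := sqrt_fix y1.
have {}ba : b^# = b by apply: ba; rewrite csadjM ha.
have bh : b ** h = h ** b.
  by apply: (bD _ (csub_commutant h)); rewrite /= csmulA.
pose i := @mleft R B; have iH := @mleft_hom R B : star_hom i.
pose e := (@mid R B : (mult : cstarType R)).
have e1 x : e ** x = x := mid_unit x.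
have ea : e^# = e := unit_adj e1.
pose H := i (f h); pose K := i (f b).
have Ha : H^# = H by rewrite /H -(homJ iH) -(homJ fh) ha.
have Ka : K^# = K by rewrite /K -(homJ iH) -(homJ fh) ba.
have KH : K ** H = H ** K by rewrite /K /H -!(homM iH) -!(homM fh) bh.
have HK : H ** H = K + K - K ** K.
  rewrite /K /H -!(homM iH) -!(homM fh) -(homD iH) -(homD fh) -(homB iH) -(homB fh).
  by rewrite -bb addrK.
have Xa : (e - K)^# = e - K by rewrite csadjD csadjN ea Ka.
have C : H ** (e - K) = (e - K) ** H.
  by rewrite csmulDl csmulDr csmulNl csmulNr KH e1 (csmul_unitr e1).
have := comm_squares Ha Xa C.
have -> : H ** H + (e - K) ** (e - K) = e.
  rewrite HK csmulDl !csmulDr !csmulNl !csmulNr !e1 (csmul_unitr e1).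
  by lin_coefs; ring.
rewrite nr_mleft => h2; rewrite -(ler_pXn2r (isT : (0 < 2)%N)) ?nnegrE ?nr_ge0//.
by rewrite expr1n (le_trans h2)// (nr_unit e1).
Qed.

Lemma hom_contr a : nr (f a) <= nr a.
Proof.
have sac h : h^# = h -> nr (f h) <= nr h.
  move=> ha; have [h0|hn] := eqVneq (nr h) 0.
    by rewrite (nr_eq0 h0) (hom0 fh) !nr0.
  have hp : 0 < nr h by rewrite lt_neqAle eq_sym hn nr_ge0.
  have := @hom_sa_contr ((nr h)^-1%:C *: h).
  rewrite csadjZr ha (homZ fh) !nrZ ger0_norm ?invr_ge0 ?nr_ge0// mulVf//.
  by move=> /(_ erefl (lexx _)); rewrite mulrC ler_pdivrMr// mul1r.
rewrite -(ler_pXn2r (isT : (0 < 2)%N)) ?nnegrE ?nr_ge0//.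
rewrite -!nr_adjM -(homJ fh) -(homM fh); apply: sac.
by rewrite csadjM csadjK.
Qed.
End Contractive.

(** * Strictly positive elements *)

Section StrictlyPositive.
Context {R : realType} {A : cstarType R}.
Implicit Types (a b c x y z p : A).

(** In terms of [z = a (1 + a)^-1] this element is [a (1 + a)^-2]. *)
Lemma resolvent_small a z : cpos a -> z^# = z -> z + a ** z = a ->
  (forall x, nr (x - z ** x) <= nr x) -> nr (z - z ** z) <= 2.
Proof.
move=> pa za zE zc; apply: le_trans (zc z) _.
have := nrBD z (z - z ** z); have := zc z.
have -> : z - (z - z ** z) = z ** z by cslin.
rewrite nr_sq//; have := nr_ge0 z; nra.
Qed.

Lemma resolvent_comm a z : cpos a -> z^# = z -> z + a ** z = a ->
  z + z ** a = a.
Proof.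
move=> /cpos_sa aa za zE; have := congr1 csadj zE.
by rewrite csadjD csadjM za aa.
Qed.

Definition strictly_pos p :=
  cpos p /\ forall x (r : R), 0 < r -> exists y, nr (x - y ** p) <= r.

(** Let [z = K p (1 + K p)^-1] and [X = c (1 - z)]. Then
    [w X^# X <= (1 - z) p (1 - z)], whose norm is at most [2 / K] by
    resolvent_small, so [X] is small for large [K]. Moreover
    [c - X = c z = K X p] is a left multiple of [p]. *)
Lemma strictly_pos_approx p c (w : R) : 0 < w -> cpos p ->
  cpos (p - w%:C *: (c^# ** c)) ->
  forall r : R, 0 < r -> exists y, nr (c - y ** p) <= r.
Proof.
move=> w0 pp pq r r0; pose K := 2 / (w * r ^+ 2).
have K0 : 0 < K by rewrite divr_gt0// mulr_gt0// exprn_gt0.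
have pa := cposZ (ltW K0) pp.
have [z [za zE zc _]] := cpos_resolvent pa.
have zE' := resolvent_comm pa za zE.
have z2 := resolvent_small pa za zE zc.
have [s [sa ss _ _]] := cpos_sqrt pq.
pose X := c - c ** z; pose Y := s - s ** z.
exists (K%:C *: X).
have -> : c - (K%:C *: X) ** p = X.
  have -> : (K%:C *: X) ** p = c ** (K%:C *: p - z ** (K%:C *: p)).
    by rewrite /X; cslin.
  by rewrite -{1}zE' addrK.
have XY : K%:C *: (w%:C *: (X^# ** X) + Y^# ** Y) = z - z ** z.
  have -> : w%:C *: (X^# ** X) + Y^# ** Y = p - z ** p - p ** z + z ** p ** z.
    have pE : p = w%:C *: (c^# ** c) + s ** s by rewrite ss addrC subrK.
    by rewrite [in RHS]pE /X /Y !csE za sa; lin_coefs; ring.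
  have -> : K%:C *: (p - z ** p - p ** z + z ** p ** z) =
     (K%:C *: p - z ** (K%:C *: p)) - (K%:C *: p - z ** (K%:C *: p)) ** z.
    by cslin.
  by rewrite -{1 3}zE' !addrK.
have := cpos_mono (cposZ (ltW w0) (cpos_adjM X)) (cpos_adjM Y).
rewrite -(ler_pM2l K0) => h.
have := le_trans h (_ : _ <= 2); rewrite -{1}(ger0_norm (ltW K0)) -nrZ XY => /(_ z2).
rewrite nrZ nr_adjM (ger0_norm (ltW w0)) /K => {}h.
have wr : 0 < w * r ^+ 2 by rewrite mulr_gt0// exprn_gt0.
rewrite -(ler_pXn2r (isT : (0 < 2)%N)) ?nnegrE ?nr_ge0 ?(ltW r0)//.
rewrite -(ler_pM2l w0).
by move: h; rewrite mulrAC ler_pdivrMr//; lra.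
Qed.

(** The element [p] is a convergent weighted sum of the [d n ^# d n] for a
    dense sequence [d]. It dominates each term, so strictly_pos_approx applies
    to every [d n]. *)
Lemma exists_strictly_pos (d : nat -> A) :
  (forall x (r : R), 0 < r -> exists n, nr (x - d n) <= r) ->
  exists p, strictly_pos p.
Proof.
move=> dd; pose w n : R := 2^-1 ^+ n.+1 / (1 + nr (d n) ^+ 2).
have w10 n : 0 < 1 + nr (d n) ^+ 2 by have := sqr_ge0 (nr (d n)); lra.
have w0 n : 0 < w n by rewrite divr_gt0// exprn_gt0// invr_gt0.
pose t n := (w n)%:C *: ((d n)^# ** d n).
have tn n : nr (t n) <= 2^-1 ^+ n.+1.
  rewrite nrZ ger0_norm ?(ltW (w0 _))// nr_adjM /w mulrAC ler_pdivrMr//.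
  by rewrite ler_wpM2l ?exprn_ge0 ?invr_ge0//; lra.
have tp n : cpos (t n) by apply: cposZ (cpos_adjM _); exact: ltW.
pose u n := \sum_(i < n) t i.
have [p pP] : exists p, forall n, nr (p - u n) <= 1 - (1 - 2^-1 ^+ n).
  apply: cs_lim => [n|r r0|n].
  - by rewrite lerBlDr lerDl exprn_ge0// invr_ge0.
  - have [n nr] : exists n, 2^-1 ^+ n < r :> R by apply: expr_small => //; lra.
    by exists n; lra.
  - rewrite /u big_ord_recr /= addrAC subrr add0r.
    by apply: le_trans (tn n) _; rewrite exprS; lra.
have pu (P : set A) : mclosed P -> (exists N, forall n, (N <= n)%N -> P (u n)) -> P p.
  move=> cP [N NP]; apply: cP => r r0.
  have [n nr] : exists n, 2^-1 ^+ n < r :> R by apply: expr_small => //; lra.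
  exists (u (N + n)%N); first by apply: NP; exact: leq_addr.
  apply: le_trans (pP _) _; rewrite subKr.
  rewrite exprD; have : (2^-1 : R) ^+ N <= 1 by rewrite exprn_ile1//; lra.
  have : 0 <= (2^-1 : R) ^+ n by rewrite exprn_ge0//; lra.
  nra.
have posp : cpos p.
  apply: (pu [set a | cpos a]) => /=; first exact: cpos_closed.
  exists 0%N => n _; rewrite /u.
  elim: n => [|n IH]; first by rewrite big_ord0; exact: cpos0.
  by rewrite big_ord_recr /=; apply: cposD.
exists p; split => // x r r0.
have r20 : 0 < r / 2 by rewrite divr_gt0.
have [k kr] := dd x _ r20.
have [|y yr] := @strictly_pos_approx p (d k) (w k) (w0 k) posp _ _ r20.
  rewrite -/(t k); apply: (pu [set a | cpos (a - t k)]) => /= [a aP|].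
    apply: cpos_closed => h /aP[b /= pb ab]; exists (b - t k) => //.
    by have -> : a - t k - (b - t k) = a - b by cslin.
  exists k.+1 => n /subnKC <-; rewrite /u.
  elim: (n - k.+1)%N => [|m IH].
    rewrite addn0 big_ord_recr /= addrK.
    elim: {n tn kr}k => [|k IH]; first by rewrite big_ord0; exact: cpos0.
    by rewrite big_ord_recr /=; apply: cposD.
  by rewrite addnS big_ord_recr /= addrAC; apply: cposD.
by exists y; have := nr_tri (d k) x (y ** p); lra.
Qed.

Lemma strictly_pos_sandwich p : strictly_pos p ->
  forall x (r : R), 0 < r -> exists y, nr (x - p ** y ** p) <= r.
Proof.
move=> [pp pd] x r r0; have pa := cpos_sa pp.
have r20 : 0 < r / 2 by rewrite divr_gt0.
have [y yr] := pd x _ r20.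
have p1 : 0 < nr p + 1 by rewrite ltr_wpDl// nr_ge0.
have [z zr] := pd y^# _ (divr_gt0 r20 p1).
exists z^#.
have := nr_tri (y ** p) x (p ** z^# ** p).
have -> : y ** p - p ** z^# ** p = (y^# - z ** p)^# ** p.
  by rewrite !csE pa.
have := nrM (y^# - z ** p)^# p; rewrite nrJ => h1 h2.
move: zr; rewrite ler_pdivlMr// => zr.
have := nr_ge0 (y^# - z ** p); lra.
Qed.
End StrictlyPositive.

(** * Images of closed subalgebras *)

Definition selfadj (R : realType) (A : cstarType R) (D : set A) :=
  forall x, D x -> D x^#.

Section ClosedImage.
Context {R : realType} {B C : cstarType R} (f : B -> C).
Hypothesis fh : star_hom f.
Implicit Types (D : set B).

Definition mclosure (P : set C) : set C :=
  [set x | forall r : R, 0 < r -> exists2 y, P y & nr (x - y) <= r].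

(** Approximate [c] by [f b] and cut [b] down to [y = b (1 + t b^# b)^-1] with
    [t = 1 / (4 d^2)]. The norm of [y] is of order [d] however large [b] is,
    and the error [f b - f y] is of third order in [f b], hence a fraction of
    [d]. *)
Lemma image_step D (d : R) c : csub D -> selfadj D -> 0 < d ->
  mclosure (f @` D) c -> nr c <= d ->
  exists y, [/\ D y, nr y <= 3 * d & nr (c - f y) <= d / 2].
Proof.
move=> cD aD d0 cc cd.
have [_ [b Db <-] bc] := cc _ (divr_gt0 d0 (ltr0n R 8)).
pose t := (4 * d ^+ 2)^-1; have t0 : 0 < t by rewrite invr_gt0 mulr_gt0// exprn_gt0.
have pa := cposZ (ltW t0) (cpos_adjM b).
have [a aE] : exists a, a = t%:C *: (b^# ** b) by eexists.
rewrite -aE in pa.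
have [z [za zE zc zD]] := cpos_resolvent pa.
have zE' := resolvent_comm pa za zE.
have z2 := resolvent_small pa za zE zc.
have Da : D a by rewrite aE; apply: csubZ => //; apply: csubM => //; apply: aD.
have Dz := zD _ cD Da.
exists (b - b ** z); split.
- by apply: csubB => //; apply: csubM.
- have E : t%:C *: ((b - b ** z)^# ** (b - b ** z)) = z - z ** z.
    have -> : t%:C *: ((b - b ** z)^# ** (b - b ** z)) =
        (a - z ** a) - (a - z ** a) ** z.
      by rewrite aE !csE za; lin_coefs; ring.
    by rewrite -{1 3}zE' !addrK.
  move: z2; rewrite -E nrZ nr_adjM ger0_norm ?(ltW t0)// => h.
  rewrite -(ler_pXn2r (isT : (0 < 2)%N)) ?nnegrE ?nr_ge0//; last first.
    by rewrite mulr_ge0 ?(ltW d0).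
  move: h; rewrite /t mulrC ler_pdivrMr ?mulr_gt0 ?exprn_gt0//.
  rewrite exprMn; have := sqr_ge0 d; lra.
have fpa := hom_cpos fh pa.
have fE : f z + f a ** f z = f a by rewrite -(homM fh) -(homD fh) zE.
have fza : (f z)^# = f z by rewrite -(homJ fh) za.
have fE' := resolvent_comm fpa fza fE.
have fz : nr (f z) <= nr (f a).
  have -> : f z = f a - f z ** f a by rewrite -{1}fE' addrK.
  apply: le_trans (cpos_expansive _ fpa) _; rewrite le_eqVlt; apply/orP; left.
  apply/eqP; congr nr.
  have -> : f a - f z ** f a + f a ** (f a - f z ** f a) =
     f a + f a ** f a - (f z + f a ** f z) ** f a by cslin.
  by rewrite fE addrK.
have -> : c - f (b - b ** z) = (c - f b) + f b ** f z.
  by rewrite (homB fh) (homM fh); lin_coefs; ring.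
have fb : nr (f b) <= 9 / 8 * d.
  by have := nr_tri c (f b) 0; rewrite !subr0 (nrB (f b)); lra.
have fa : nr (f a) <= t * (9 / 8 * d) ^+ 2.
  rewrite aE (homZ fh) (homM fh) (homJ fh) nrZ nr_adjM ger0_norm ?(ltW t0)//.
  rewrite ler_wpM2l ?(ltW t0)// ler_pXn2r ?nnegrE ?nr_ge0//; lra.
have td : t * d ^+ 2 = 4^-1.
  by rewrite /t; field; apply: lt0r_neq0.
have {}fa : nr (f a) <= 81 / 256.
  by apply: le_trans fa _; rewrite exprMn mulrCA td; lra.
have := nrD (c - f b) (f b ** f z); have := nrM (f b) (f z).
have := ler_pM (nr_ge0 _) (nr_ge0 _) fb (le_trans fz fa).
(* The total error is [1/8 + 9/8 * 81/256 < 1/2] times [d]. *)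
lra.
Qed.

(** Iterating image_step with [d] halved each time writes a limit point of the
    image as [f] of a convergent series in [D]. *)
Lemma mclosed_image D : csub D -> selfadj D -> mclosed (f @` D).
Proof.
move=> cD aD c cc.
pose q n : R := (nr c + 1) * 2^-1 ^+ n.
have c1 : 0 < nr c + 1 by rewrite ltr_wpDl// nr_ge0.
have q0 n : 0 < q n by rewrite mulr_gt0// exprn_gt0// invr_gt0.
have qS n : q n.+1 = q n / 2 by rewrite /q exprS; lra.
have qs (r : R) : 0 < r -> exists n, q n < r.
  move=> r0; have [n nr] : exists n, 2^-1 ^+ n < r / (nr c + 1).
    by apply: expr_small; [lra|lra|exact: divr_gt0].
  by exists n; rewrite /q mulrC -ltr_pdivlMr.
have /choice[Y YP] : forall x : nat * C, exists y, D y /\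
    (mclosure (f @` D) x.2 -> nr x.2 <= q x.1 ->
     nr y <= 3 * q x.1 /\ nr (x.2 - f y) <= q x.1.+1).
  move=> [n x] /=.
  (* The condition is imposed inside, so that [Y] is total. *)
  have [[h1 h2]|h] := pselect (mclosure (f @` D) x /\ nr x <= q n).
    have [y [Dy y1 y2]] := image_step cD aD (q0 n) h1 h2.
    by exists y; split => // _ _; rewrite qS.
  by exists 0; split; [exact: csub0|move=> h1 h2; case: h].
pose s := fix s n := if n is n'.+1 then s n' + Y (n', c - f (s n')) else 0.
have Ds n : D (s n).
  elim: n => [|n IH] /=; first exact: csub0.
  by apply: csubD => //; exact: (YP _).1.
have clos n : mclosure (f @` D) (c - f (s n)).
  move=> r /cc[_ [y Dy <-] yr]; exists (f (y - s n)).
    by exists (y - s n) => //; apply: csubB.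
  by have -> : c - f (s n) - f (y - s n) = c - f y
    by rewrite (homB fh); lin_coefs; ring.
have sq n : nr (c - f (s n)) <= q n.
  elim: n => [|n IH]; first by rewrite /= (hom0 fh) subr0 /q expr0; lra.
  have := ((YP (n, c - f (s n))).2 (clos n) IH).2.
  by rewrite /= (homD fh) opprD addrA.
have [l lP] : exists l, forall n, nr (l - s n) <= 0 - (- 6 * q n).
  apply: cs_lim => [n|r r0|n].
  - by have := q0 n; lra.
  - have [n nr] := qs (r / 6) (divr_gt0 r0 (ltr0n R 6)); exists n; lra.
  - have := ((YP (n, c - f (s n))).2 (clos n) (sq n)).1.
    rewrite /= -/s; rewrite (addrC (s n)) addrK qS; lra.
exists l.
  apply: csub_closed (cD) _ _ => r r0.
  have [n nr] := qs (r / 6) (divr_gt0 r0 (ltr0n R 6)); exists (s n) => //.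
  by have := lP n; lra.
apply/subr0_eq/(@nr_small _ _ 7) => r /qs[n nr].
have := nr_tri (f (s n)) (f l) c; rewrite -(homB fh).
have := hom_contr fh (l - s n); have := sq n; have := lP n.
rewrite (nrB c); lra.
Qed.
End ClosedImage.

(** * Lifting orthogonality *)

Section OrthogonalLift.
Context {R : realType} {B C : cstarType R} (f : B -> C).
Hypothesis fh : star_hom f.
Implicit Types (D : set B).

Lemma csub_preimage (E : set C) : csub E -> csub (f @^-1` E).
Proof.
move=> cE; constructor => /=.
- by rewrite (hom0 fh); exact: csub0.
- by move=> x y Ex Ey; rewrite (homD fh); exact: csubD.
- by move=> c x Ex; rewrite (homZ fh); exact: csubZ.
- by move=> x y Ex Ey; rewrite (homM fh); exact: csubM.
- move=> x xE; apply: csub_closed (cE) _ _ => r /xE[y /= Ey xy].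
  by exists (f y) => //; rewrite -(homB fh); apply: le_trans (hom_contr fh _) xy.
Qed.

Lemma csub_setI D D' : csub D -> csub D' -> csub (D `&` D').
Proof.
move=> cD cE; constructor.
- by split; exact: csub0.
- by move=> x y [? ?] [? ?]; split; exact: csubD.
- by move=> c x [? ?]; split; exact: csubZ.
- by move=> x y [? ?] [? ?]; split; exact: csubM.
- move=> x xE; split; [apply: csub_closed (cD) _ _|apply: csub_closed (cE) _ _];
  by move=> r /xE[y [? ?] xy]; exists y.
Qed.

Definition annihilator (S : set B) : set B :=
  [set x | forall s, S s -> x ** s = 0 /\ s ** x = 0].

Lemma csub_annihilator (S : set B) : csub (annihilator S).
Proof.
constructor.
- by move=> s _; rewrite csmul0l csmul0r.
- move=> x y Sx Sy s Ss; have [h1 h2] := Sx s Ss; have [h3 h4] := Sy s Ss.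
  by rewrite csmulDl csmulDr h1 h2 h3 h4 addr0.
- move=> c x Sx s Ss; have [h1 h2] := Sx s Ss.
  by rewrite csmulZl csmulZr h1 h2 scaler0.
- move=> x y Sx Sy s Ss; have [h1 h2] := Sx s Ss; have [h3 h4] := Sy s Ss.
  by rewrite -csmulA h3 csmulA h2 csmul0l csmul0r.
- move=> x xS s Ss; split; apply: (@nr_small _ _ (nr s)) => r /xS[y yS xy];
    have [h1 h2] := yS s Ss.
    have -> : x ** s = (x - y) ** s by rewrite csmulDl csmulNl h1 subr0.
    by apply: le_trans (nrM _ _) _; rewrite mulrC ler_wpM2l ?nr_ge0.
  have -> : s ** x = s ** (x - y) by rewrite csmulDr csmulNr h2 subr0.
  by apply: le_trans (nrM _ _) _; rewrite ler_wpM2l ?nr_ge0.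
Qed.

Lemma selfadj_annihilator (S : set B) : selfadj S -> selfadj (annihilator S).
Proof.
move=> aS x Sx s Ss; have [h1 h2] := Sx _ (aS _ Ss).
by split; apply: (inv_inj csadjK); rewrite csadjM csadjK csadj0.
Qed.

Lemma selfadj_setI D D' : selfadj D -> selfadj D' -> selfadj (D `&` D').
Proof. by move=> aD aE x [? ?]; split; [exact: aD|exact: aE]. Qed.

Definition orthogonal (D D' : set B) :=
  forall x y, D x -> D' y -> x ** y = 0 /\ y ** x = 0.

(** Here [m = |x|] for a self-adjoint lift [x] of [k - l]. Positive roots are
    unique, so [f m = k + l] and [f] maps [x1 = m + x] and [x2 = m - x] to
    [2 k] and [2 l]. Take for [D1] the annihilator of [x2], which contains
    [x1 D x1], and for [D2] the annihilator of [D1], which contains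
    [x2 D x2]. *)
Lemma orthogonal_lift D (k l : C) : csub D -> selfadj D ->
  cpos k -> cpos l -> k ** l = 0 -> (f @` D) (k - l) ->
  exists D1 D2, [/\ [/\ csub D1, selfadj D1 & D1 `<=` D],
    [/\ csub D2, selfadj D2 & D2 `<=` D], orthogonal D1 D2 &
    forall c, (f @` D) c -> (f @` D1) (k ** c ** k) /\ (f @` D2) (l ** c ** l)].
Proof.
move=> cD aD pk pl kl [x0 Dx0 fx0].
have ka := cpos_sa pk; have la := cpos_sa pl.
have lk : l ** k = 0 by apply: (inv_inj csadjK); rewrite csadjM ka la kl csadj0.
have [x [Dx xa fx]] : exists x, [/\ D x, x^# = x & f x = k - l].
  exists ((2^-1)%:C *: (x0 + x0^#)); split.
  - by apply: csubZ => //; apply: csubD => //; apply: aD.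
  - by rewrite !csE addrC.
  - by rewrite (homZ fh) (homD fh) (homJ fh) fx0 !csE ka la; lin_coefs; field.
have [m [ma mm pm mD]] := cpos_sqrt (cpos_sq xa).
have Dm : D m by apply: mD => //; exact: csubM.
have mx : m ** x = x ** m.
  by apply: (mD _ (csub_commutant x)); rewrite /= csmulA.
have kl2 : (k - l) ** (k - l) = (k + l) ** (k + l).
  by rewrite !csE kl lk; lin_coefs; ring.
have fm : f m = k + l.
  apply: sqrt_uniq.
  - exact: hom_cpos.
  - exact: cposD.
  - apply: (mD _ (csub_preimage (csub_commutant (k + l)))).
    by rewrite /= (homM fh) fx kl2 csmulA.
  - by rewrite -(homM fh) mm (homM fh) fx.
have x12 : (m + x) ** (m - x) = 0 by rewrite !csE mm mx; lin_coefs; ring.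
have x21 : (m - x) ** (m + x) = 0 by rewrite !csE mm mx; lin_coefs; ring.
have fx1 : f (m + x) = 2%:C *: k by rewrite (homD fh) fm fx; lin_coefs; ring.
have fx2 : f (m - x) = 2%:C *: l by rewrite (homB fh) fm fx; lin_coefs; ring.
have Dx1 : D (m + x) by exact: csubD.
have Dx2 : D (m - x) by exact: csubB.
have x2a : (m - x)^# = m - x by rewrite csadjD csadjN ma xa.
move: (m + x) (m - x) fx1 fx2 Dx1 Dx2 x12 x21 x2a.
move=> x1 x2 fx1 fx2 Dx1 Dx2 x12 x21 x2a.
pose D1 := D `&` annihilator [set x2]; pose D2 := D `&` annihilator D1.
have aD1 : selfadj D1.
  by apply: selfadj_setI => //; apply: selfadj_annihilator => _ ->.
exists D1, D2; split.
- split=> //; first by apply: csub_setI => //; exact: csub_annihilator.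
  exact: subIsetl.
- split; first by apply: csub_setI => //; exact: csub_annihilator.
    by apply: selfadj_setI => //; exact: selfadj_annihilator.
  exact: subIsetl.
- by move=> y z D1y [_ /(_ y D1y)[? ?]].
move=> _ [b Db <-]; split.
  exists ((4^-1)%:C *: (x1 ** b ** x1)).
    apply: csubZ; first by apply: csub_setI => //; exact: csub_annihilator.
    split; first by apply: csubM => //; apply: csubM.
    move=> _ ->; rewrite -csmulA x12 csmul0r; split=> //.
    by rewrite !csmulA x21 !csmul0l.
  by rewrite (homZ fh) !(homM fh) fx1; cslin_field.
exists ((4^-1)%:C *: (x2 ** b ** x2)).
  apply: csubZ; first by apply: csub_setI => //; exact: csub_annihilator.
  split; first by apply: csubM => //; apply: csubM.
  move=> y [_ /(_ x2 erefl)[yx xy]].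
  by rewrite -csmulA xy csmul0r !csmulA yx !csmul0l.
by rewrite (homZ fh) !(homM fh) fx2; cslin_field.
Qed.
End OrthogonalLift.

Section OrthogonalFamily.
Context {R : realType} {I : choiceType} {A : I -> cstarType R} {B C : cstarType R}.
Variables (f : B -> C) (phi : forall i, A i -> C) (p : forall i, A i).
Arguments phi : clear implicits.
Arguments p : clear implicits.
Hypothesis fh : star_hom f.
Hypothesis phih : forall i, star_hom (phi i).
Hypothesis phi_orth : forall i j, i != j ->
  forall x y, phi i x ** phi j y = 0.
Hypothesis pp : forall i, strictly_pos (p i).

(** The elements [p x p] are dense when [p] is strictly positive, and the image
    of [D] is closed. *)
Lemma image_sandwich (D : set B) i (k : C) : csub D -> selfadj D ->
  (forall x, phi i (p i ** x ** p i) = k ** phi i x ** k) ->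
  (forall x, (f @` D) (k ** phi i x ** k)) -> forall x, (f @` D) (phi i x).
Proof.
move=> cD aD phik Dk x; apply: mclosed_image => // r r0.
have [y yr] := strictly_pos_sandwich (pp i) x r0.
exists (phi i (p i ** y ** p i)); first by rewrite phik.
by rewrite -(homB (phih i)); apply: le_trans (hom_contr (phih i) _) yr.
Qed.

(** Induction on [s]: orthogonal_lift splits off the first index, and the
    second subalgebra that it yields takes the place of [D] for the others. *)
Lemma orthogonal_family (s : seq I) (D : set B) : uniq s ->
  csub D -> selfadj D -> (forall i, i \in s -> forall x, (f @` D) (phi i x)) ->
  exists E : I -> set B, [/\
    forall i, i \in s -> [/\ csub (E i), selfadj (E i) & E i `<=` D],
    forall i, i \in s -> forall x, (f @` E i) (phi i x) &
    forall i j, i \in s -> j \in s -> i != j -> orthogonal (E i) (E j)].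
Proof.
elim: s D => [|i s IH] D /=; first by exists (fun=> D).
move=> /andP[is_ us] cD aD Df.
pose k := phi i (p i); pose l := \sum_(j <- s) phi j (p j).
have pk : cpos k by apply: hom_cpos => //; case: (pp i).
have pl : cpos l.
  rewrite /l; elim: (s) => [|j t IHt]; rewrite ?big_nil ?big_cons; first exact: cpos0.
  by apply: cposD => //; apply: hom_cpos => //; case: (pp j).
have suml (F : I -> C) c : (\sum_(j <- s) F j) ** c = \sum_(j <- s) F j ** c.
  elim: (s) => [|j t IHt]; rewrite ?big_nil ?big_cons ?csmul0l//.
  by rewrite csmulDl IHt.
have sumr (F : I -> C) c : c ** (\sum_(j <- s) F j) = \sum_(j <- s) c ** F j.
  elim: (s) => [|j t IHt]; rewrite ?big_nil ?big_cons ?csmul0r//.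
  by rewrite csmulDr IHt.
have kl : k ** l = 0.
  rewrite /l sumr big_seq big1// => j js; apply: phi_orth.
  by apply: contraNneq is_ => ->.
have Dkl : (f @` D) (k - l).
  have [x Dx fx] : (f @` D) k by apply: Df; exact: mem_head.
  have [y Dy fy] : (f @` D) l.
    rewrite /l big_seq; apply: (big_ind (f @` D)).
    - by exists 0; [exact: csub0|exact: hom0].
    - move=> _ _ [y Dy <-] [z Dz <-]; exists (y + z); first exact: csubD.
      exact: homD.
    - by move=> j js; apply: Df; rewrite inE js orbT.
  by exists (x - y); [exact: csubB|rewrite (homB fh) fx fy].
have [D1 [D2 [[c1 a1 s1] [c2 a2 s2] orth lift]]] :=
  orthogonal_lift fh cD aD pk pl kl Dkl.
have D1phi : forall x, (f @` D1) (phi i x).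
  apply: (image_sandwich (k := k)) => // x; first by rewrite !(homM (phih i)).
  by apply: (lift _ _).1; apply: Df; exact: mem_head.
have D2phi j : j \in s -> forall x, (f @` D2) (phi j x).
  move=> js; apply: (image_sandwich (k := l)) => // x; last first.
    by apply: (lift _ _).2; apply: Df; rewrite inE js orbT.
  rewrite !(homM (phih j)).
  have lj y : l ** phi j y = phi j (p j) ** phi j y.
    rewrite /l suml (bigD1_seq j)//= big1 ?addr0// => h hj.
    exact: phi_orth.
  have jl y : phi j y ** l = phi j y ** phi j (p j).
    rewrite /l sumr (bigD1_seq j)//= big1 ?addr0// => h hj.
    by apply: phi_orth; rewrite eq_sym.
  by rewrite lj -[RHS]csmulA jl csmulA.
have [E [E1 E2 E3]] := IH D2 us c2 a2 D2phi.
exists (fun j => if j == i then D1 else E j); split.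
- move=> j; rewrite inE; case: eqP => //= _ /E1[? ? ?]; split=> //.
  by apply: subset_trans s2.
- by move=> j; rewrite inE; case: eqP => [->//|_ /=]; exact: E2.
- move=> j h; rewrite !inE; case: (eqVneq j i) => [->|ji] /=.
    rewrite eq_sym; case: (eqVneq h i) => //= hi _ hs _ x y D1x Ehy.
    by apply: orth => //; have [_ _] := E1 h hs; apply.
  case: (eqVneq h i) => [_ js _ _|hi js hs]; last exact: E3.
  move=> x y Ejx D1y; have [_ _ /(_ x Ejx) D2x] := E1 j js.
  by have [] := orth y x D1y D2x.
Qed.
End OrthogonalFamily.

(** * Closed self-adjoint subalgebras as C*-algebras *)

Record csubalg (R : realType) (A : cstarType R) := CSubalg {
  csa_set :> set A;
  csa_csub : csub csa_set;
  csa_adj : selfadj csa_set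
}.

Section Subalgebra.
Context {R : realType} {A : cstarType R} (D : csubalg A).

Record subcs := SubCS { csval :> A; csvalP : csa_set D csval }.
Implicit Types (a b c : subcs).

Lemma csval_inj a b : csval a = csval b -> a = b.
Proof.
by case: a b => [a pa] [b pb] /= ab; subst; congr SubCS; apply: Prop_irrelevance.
Qed.

HB.instance Definition _ := gen_eqMixin subcs.
HB.instance Definition _ := gen_choiceMixin subcs.

Let cD := csa_csub D.
Definition sub0 := SubCS (csub0 cD).
Definition subadd a b := SubCS (csubD cD (csvalP a) (csvalP b)).
Definition subscale (k : R[i]) a := SubCS (csubZ cD k (csvalP a)).
Definition subopp a := subscale (-1) a.
Definition submul a b := SubCS (csubM cD (csvalP a) (csvalP b)).
Definition subadj a := SubCS (csa_adj (csvalP a)).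

Fact subaddA : associative subadd.
Proof. by move=> a b c; apply: csval_inj => /=; rewrite addrA. Qed.
Fact subaddC : commutative subadd.
Proof. by move=> a b; apply: csval_inj => /=; rewrite addrC. Qed.
Fact subadd0 : left_id sub0 subadd.
Proof. by move=> a; apply: csval_inj => /=; rewrite add0r. Qed.
Fact subaddN : left_inverse sub0 subopp subadd.
Proof. by move=> a; apply: csval_inj => /=; rewrite scaleN1r addNr. Qed.
HB.instance Definition _ :=
  GRing.isZmodule.Build subcs subaddA subaddC subadd0 subaddN.

Fact subscaleA k l a : subscale k (subscale l a) = subscale (k * l) a.
Proof. by apply: csval_inj => /=; rewrite scalerA. Qed.
Fact subscale1 : left_id 1 subscale.
Proof. by move=> a; apply: csval_inj => /=; rewrite scale1r. Qed.
Fact subscaleDr : right_distributive subscale +%R.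
Proof. by move=> k a b; apply: csval_inj => /=; rewrite scalerDr. Qed.
Fact subscaleDl a : {morph subscale^~ a : k l / k + l}.
Proof. by move=> k l; apply: csval_inj => /=; rewrite scalerDl. Qed.
HB.instance Definition _ := GRing.Zmodule_isLmodule.Build R[i] subcs
  subscaleA subscale1 subscaleDr subscaleDl.

Lemma csvalB a b : csval (a - b) = csval a - csval b.
Proof. by rewrite -(scaleN1r (csval b)). Qed.

Fact subnormD a b : `|csval (a + b)| <= `|csval a| + `|csval b|.
Proof. exact: ler_normD. Qed.
Fact subnormZ (k : R[i]) a : `|csval (k *: a)| = `|k| * `|csval a|.
Proof. exact: normrZ. Qed.
Fact subnorm_eq0 a : `|csval a| = 0 -> a = 0.
Proof. by move=> /normr0_eq0 a0; apply: csval_inj. Qed.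
HB.instance Definition _ := Lmodule_isNormed.Build R[i] subcs
  subnormD subnormZ subnorm_eq0.

Lemma subnormE a : `|a| = `|csval a|. Proof. by []. Qed.

Fact sub_complete (F : set_system subcs) : ProperFilter F -> cauchy F -> cvg F.
Proof.
move=> FF /cauchyP Fc.
have /cvg_ex[l Fl] : cvg (csval @ F).
  apply: cauchy_cvg; apply: cauchy_exP => e e0.
  have [a Fa] := Fc _ e0; exists (csval a).
  change (F (csval @^-1` ball (csval a) e)).
  apply: filterS Fa => b; rewrite -!ball_normE /= => ab.
  by rewrite -csvalB; exact: ab.
have Flr (e : R[i]) : 0 < e -> F [set a : subcs | `|l - csval a| < e].
  move=> e0; have := Fl _ (nbhsx_ballx l _ e0).
  by rewrite -ball_normE.
have Dl : csa_set D l.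
  apply: csub_closed (cD) _ _ => r r0.
  have rc0 : 0 < r%:C :> R[i] by rewrite ltcR.
  have [a /= la] := filter_ex (Flr _ rc0); exists (csval a).
    exact: csvalP.
  by move: la; rewrite -nrE ltcR => /ltW.
apply/cvg_ex; exists (SubCS Dl); apply/cvg_ballP => e e0.
apply: filterS (Flr _ e0) => a /= la; rewrite -ball_normE /= subnormE.
by rewrite csvalB.
Qed.
HB.instance Definition _ := Uniform_isComplete.Build subcs sub_complete.

Fact submulA : associative submul.
Proof. by move=> a b c; apply: csval_inj => /=; rewrite csmulA. Qed.
Fact submulDl : left_distributive submul +%R.
Proof. by move=> a b c; apply: csval_inj => /=; rewrite csmulDl. Qed.
Fact submulDr : right_distributive submul +%R.
Proof. by move=> a b c; apply: csval_inj => /=; rewrite csmulDr. Qed.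
Fact submulZl (k : R[i]) a b : submul (k *: a) b = k *: submul a b.
Proof. by apply: csval_inj => /=; rewrite csmulZl. Qed.
Fact submulZr (k : R[i]) a b : submul a (k *: b) = k *: submul a b.
Proof. by apply: csval_inj => /=; rewrite csmulZr. Qed.
Fact subnormM a b : `|submul a b| <= `|a| * `|b|.
Proof. exact: csnormM. Qed.
Fact subadjK : involutive subadj.
Proof. by move=> a; apply: csval_inj => /=; rewrite csadjK. Qed.
Fact subadjD : {morph subadj : a b / a + b}.
Proof. by move=> a b; apply: csval_inj => /=; rewrite csadjD. Qed.
Fact subadjZ (k : R[i]) a : subadj (k *: a) = k^* *: subadj a.
Proof. by apply: csval_inj => /=; rewrite csadjZ. Qed.
Fact subadjM a b : subadj (submul a b) = submul (subadj b) (subadj a).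
Proof. by apply: csval_inj => /=; rewrite csadjM. Qed.
Fact subnorm_adj a : `|submul (subadj a) a| = `|a| ^+ 2.
Proof. exact: csnorm_adj. Qed.
HB.instance Definition _ := isCStarAlgebra.Build R subcs
  submulA submulDl submulDr submulZl submulZr subnormM
  subadjK subadjD subadjZ subadjM subnorm_adj.

Lemma csval_hom : star_hom (csval : (subcs : cstarType R) -> A).
Proof. by split. Qed.
End Subalgebra.

(** * Maps into and out of the direct sum *)

Lemma cvg0P (R : realType) (V : cstarType R) (u : nat -> V) :
  ((`|u n| : R[i]^o) @[n --> \oo] --> (0 : R[i]^o)) <->
  forall r : R, 0 < r -> exists N, forall n, (N <= n)%N -> nr (u n) < r.
Proof.
have key (r : R) n : (`|(0 : R[i]^o) - (`|u n| : R[i]^o)| < r%:C) = (nr (u n) < r).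
  by rewrite sub0r normrN normr_id -nrE ltcR.
split.
  move=> uc r r0; have rc0 : 0 < r%:C :> R[i] by rewrite ltcR.
  have [N _ uN] := uc _ (nbhsx_ballx (0 : R[i]^o) _ rc0).
  by exists N => n /uN; rewrite /= -key -ball_normE.
move=> uc; apply/cvg_ballP => e /posCre[r r0 ->].
have [N uN] := uc r r0; exists N => // n Nn.
by rewrite /= -ball_normE /= key; exact: uN.
Qed.

Lemma star_hom_comp (R : realType) (A B C : cstarType R) (f : A -> B) (g : B -> C) :
  star_hom f -> star_hom g -> star_hom (g \o f).
Proof.
move=> fh gh; split=> [c x y|x y|x] /=.
- by rewrite (homD fh) (homZ fh) (homD gh) (homZ gh).
- by rewrite (homM fh) (homM gh).
- by rewrite (homJ fh) (homJ gh).
Qed.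

Section C0SumMaps.
Context {R : realType} {I : countType} {A : I -> cstarType R}.
Local Notation S := (c0sum A : cstarType R).
Implicit Types (a b : S).

Lemma c0nr_ge a i : nr (a i) <= nr a.
Proof. by rewrite -lecR !nrE; exact: c0norm_ge. Qed.
Lemma c0nr_le a (K : R) : 0 <= K -> (forall i, nr (a i) <= K) -> nr a <= K.
Proof.
move=> K0 aK; rewrite -lecR nrE; apply: c0norm_le => [|i]; first by rewrite lecR.
by rewrite -nrE lecR.
Qed.

Definition c0proj i a : A i := a i.
Lemma c0proj_hom i : star_hom (c0proj i).
Proof. by split. Qed.

Lemma vanishing_finite (f : forall i, A i) (s : seq I) :
  (forall i, i \notin s -> f i = 0) -> vanishing f.
Proof.
move=> f0; apply/vanishingP => e e0.
apply: sub_finite_set (finite_seq s) => i /= h.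
apply: contraT => /f0 fi; move: h; rewrite fi normr0 lecR leNgt e0//.
Qed.

Lemma c0_tail a (r : R) : 0 < r -> exists s : seq I,
  forall i, i \notin s -> nr (a i) <= r.
Proof.
have /vanishingP va := c0valP a.
move=> /va/finite_seqP[s sE]; exists s => i is_.
rewrite leNgt; apply/negP => ri; move/negP: is_; apply.
have : [set` s] i by rewrite -sE /= -nrE lecR ltW.
by [].
Qed.

Fact c0inj_vanishing i (x : A i) :
  vanishing (dfwith (fun j => 0 : A j) i x).
Proof.
apply: (@vanishing_finite _ [:: i]) => j; rewrite inE => ji.
by rewrite dfwithout// eq_sym.
Qed.
Definition c0inj i (x : A i) : S := C0Sum (c0inj_vanishing x).

Lemma c0inj_in i (x : A i) : c0inj x i = x.
Proof. exact: dfwithin. Qed.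
Lemma c0inj_out i j (x : A i) : i != j -> c0inj x j = 0.
Proof. by move=> ij; exact: dfwithout. Qed.

Lemma c0inj_hom i : star_hom (@c0inj i).
Proof.
split=> [c x y|x y|x]; apply: c0sumP => j; have [->|ij] := eqVneq j i;
  rewrite ?c0valD ?c0valZ ?c0valM ?c0val_adj ?c0inj_in// !c0inj_out 1?eq_sym//.
- by rewrite scaler0 addr0.
- by rewrite csmul0l.
- by rewrite csadj0.
Qed.

Lemma c0inj_orth i j (x : A i) (y : A j) : i != j -> c0inj x ** c0inj y = 0.
Proof.
move=> ij; apply: c0sumP => k; rewrite c0valM c0val0.
have [ik|ik] := eqVneq i k; last by rewrite c0inj_out// csmul0l.
by rewrite (c0inj_out y) ?csmul0r// -ik eq_sym.
Qed.

Lemma c0_sum_inj (s : seq I) a j : uniq s ->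
  (\sum_(i <- s) c0inj (a i)) j = if j \in s then a j else 0.
Proof.
elim: s => [|i s IH] /=; first by rewrite big_nil.
move=> /andP[is_ us]; rewrite big_cons c0valD IH// inE.
have [->|ji] := eqVneq j i.
  by rewrite c0inj_in (negbTE is_) addr0.
by rewrite c0inj_out 1?eq_sym// add0r.
Qed.
End C0SumMaps.

(** * Separability *)

Section Separable.
Context {R : realType}.

Lemma separableP (A : cstarType R) : separable A <->
  exists d : nat -> A, forall x (r : R), 0 < r -> exists n, nr (x - d n) <= r.
Proof.
split.
  move=> [D [cD dD]].
  have [x0 [_ Dx0]] := dD setT (ex_intro _ (0 : A) I) openT.
  move: cD => /pfcard_geP[D0|[d]]; first by rewrite D0 in Dx0.
  exists d => x r r0.
  have rc0 : 0 < r%:C :> R[i] by rewrite ltcR.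
  have ne : (ball x r%:C)° !=set0 by exists x; exact: (nbhsx_ballx x _ rc0).
  have [y [xy Dy]] := dD _ ne (open_interior _).
  have [n _ dn] := @surj _ _ _ _ d y Dy; exists n; rewrite dn.
  have := interior_subset xy.
  by rewrite -ball_normE /= -nrE ltcR => /ltW.
move=> [d dd]; exists (range d); split; first exact: card_image_le.
move=> O [x Ox] oO.
have : nbhs x O by exact: open_nbhs_nbhs.
move=> /nbhs_ballP[e /= e0]; have [r r0 ->] := posCre e0 => eO.
have [n nr] := dd x _ (divr_gt0 r0 (ltr0n R 2)); exists (d n); split.
  by apply: eO; rewrite -ball_normE /= -nrE ltcR; lra.
by exists n.
Qed.
End Separable.

Section C0SumSeparable.
Context {R : realType} {I : countType} {A : I -> cstarType R}.
Local Notation S := (c0sum A : cstarType R).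

(** The finitely supported families with entries in dense sequences of the
    summands are dense. They are indexed by a bound on the codes of the support
    and the list of the positions of the entries. *)
Lemma separable_c0sum : (forall i, separable (A i)) -> separable S.
Proof.
move=> sepA; have dP i : exists d : nat -> A i, forall x (r : R), 0 < r ->
  exists n, nr (x - d n) <= r by apply/separableP.
pose d i := projT1 (cid (dP i)).
have dP' i x (r : R) : 0 < r -> exists n, nr (x - d i n) <= r.
  exact: (projT2 (cid (dP i))).
pose g (n : nat) (s : seq nat) i : A i :=
  if (pickle i < n)%N then d i (nth 0%N s (pickle i)) else 0.
have gv n s : vanishing (g n s).
  apply: (@vanishing_finite _ _ _ _ (pmap unpickle (iota 0 n))) => i is_.
  rewrite /g; case: ifP => // lt_in; case/negP: is_.
  rewrite mem_pmap; apply/mapP; exists (pickle i); last by rewrite pickleK.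
  by rewrite mem_iota.
apply/separableP.
exists (fun k => if unpickle k is Some (n, s) then C0Sum (gv n s) : S else 0).
move=> x r r0; have [s sr] := c0_tail x r0.
pose n := (\max_(i <- s) pickle i).+1.
have /choice[h hP] : forall k, exists m, forall i, pickle i = k ->
    nr (x i - d i m) <= r.
  move=> k; case E : (@pickle_inv I k) => [i|].
    have [m mr] := dP' i (x i) _ r0; exists m => j jk.
    by move: E; rewrite -jk pickleK_inv => -[ji]; subst.
  by exists 0%N => i ik; move: E; rewrite -ik pickleK_inv.
exists (pickle (n, mkseq h n)); rewrite pickleK.
apply: c0nr_le => [|i]; first exact: ltW.
rewrite c0valB /= /g; case: ifP => ltin.
  by rewrite nth_mkseq//; exact: hP.
rewrite subr0; apply: sr; apply/negP => is_; move/negP: ltin; apply.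
by rewrite /n ltnS; apply: leq_bigmax_seq.
Qed.
End C0SumSeparable.

(** * Weak projectivity of the direct sum *)

Section Pullback.
Context {R : realType} {A B C : cstarType R}.
Variables (phi : A -> C) (f : B -> C) (E : set B).
Hypotheses (phih : star_hom phi) (fh : star_hom f).
Hypotheses (cE : csub E) (aE : selfadj E).

(** The product of two C*-algebras, as a direct sum indexed by [bool]. *)
Definition pair_fam (b : bool) : cstarType R := if b then A else B.
Local Notation P := (c0sum pair_fam : cstarType R).

Definition pullback : set P :=
  [set w : c0sum pair_fam | phi (w true) = f (w false) /\ E (w false)].

Lemma csub_pullback : csub pullback.
Proof.
constructor.
- by split; rewrite !c0val0; [rewrite (hom0 phih) (hom0 fh)|exact: csub0].
- move=> x y [? ?] [? ?]; split; rewrite !c0valD; last exact: csubD.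
  by rewrite (homD phih) (homD fh); congr (_ + _).
- move=> c x [? ?]; split; rewrite !c0valZ; last exact: csubZ.
  by rewrite (homZ phih) (homZ fh); congr (_ *: _).
- move=> x y [? ?] [? ?]; split; rewrite !c0valM; last exact: csubM.
  by rewrite (homM phih) (homM fh); congr (_ ** _).
move=> x xP; split; last first.
  apply: csub_closed (cE) _ _ => r /xP[y [_ Ey] xy]; exists (y false) => //.
  by apply: le_trans xy; have := c0nr_ge (x - y) false; rewrite c0valB.
apply/subr0_eq/(@nr_small _ _ 2) => r /xP[y [yE _] xy].
have := c0nr_ge (x - y) false; have := c0nr_ge (x - y) true.
rewrite !c0valB => h1 h2.
have := hom_contr phih (x true - y true); have := hom_contr fh (x false - y false).
rewrite (homB phih) (homB fh) yE => h3 h4.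
have := nr_tri (f (y false)) (phi (x true)) (f (x false)).
rewrite (nrB (f (y false))).
move: (le_trans h3 (le_trans h2 xy)) (le_trans h4 (le_trans h1 xy)); lra.
Qed.

Lemma selfadj_pullback : selfadj pullback.
Proof.
move=> x [? ?]; split; rewrite !c0val_adj; last exact: aE.
by rewrite (homJ phih) (homJ fh); congr csadj.
Qed.

Definition pullback_alg := CSubalg csub_pullback selfadj_pullback.

(** The first projection of the pullback is onto [A], because [f @` E] contains
    the range of [phi]. An approximate lift of the identity of [A] along it has
    the form [(u n, psi n)] with [f (psi n a) = phi (u n a)] and [u n a] close
    to [a]. *)
Lemma weakly_projective_lift : weakly_projective A ->
  (forall a, (f @` E) (phi a)) ->
  exists psi : nat -> A -> B, [/\ forall n, star_hom (psi n),
    forall n a, E (psi n a) &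
    forall a (r : R), 0 < r -> exists N, forall n, (N <= n)%N ->
      nr (f (psi n a) - phi a) < r].
Proof.
move=> [_ wA] fE.
pose Q := subcs pullback_alg : cstarType R.
pose rho (w : Q) : A := csval w true.
have rhoh : star_hom rho.
  exact: (star_hom_comp (csval_hom pullback_alg) (c0proj_hom (A := pair_fam) true)).
have idh : star_hom (fun a : A => a) by split.
have rhos : set_surj setT setT rho.
  move=> a _; have [b Eb fb] := fE a.
  pose w i : pair_fam i := if i as i return pair_fam i then a else b.
  have w0 i : i \notin [:: true; false] -> w i = 0 by case: i.
  have wv : vanishing w by exact: vanishing_finite w0.
  have wP : pullback (C0Sum wv) by split.
  by exists (SubCS (wP : csa_set pullback_alg _)).
have [th [thh thc]] := wA Q A _ rho idh rhoh rhos.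
exists (fun n a => csval (th n a) false); split.
- move=> n; have h2 : star_hom (fun w : Q => csval w false).
    exact: (star_hom_comp (csval_hom pullback_alg) (c0proj_hom (A := pair_fam) false)).
  exact: (star_hom_comp (thh n) h2).
- by move=> n a; have [] := csvalP (th n a).
move=> a r /((cvg0P _).1 (thc a))[N NP]; exists N => n /NP.
have [<- _] := csvalP (th n a); apply: le_lt_trans.
by rewrite -(homB phih); exact: hom_contr.
Qed.
End Pullback.

Section SumOfOrthogonal.
Context {R : realType} {I : countType} {A : I -> cstarType R} {B : cstarType R}.
Local Notation S := (c0sum A : cstarType R).

Lemma star_hom_sum (s : seq I) (psi : forall i, A i -> B) : uniq s ->
  (forall i, i \in s -> star_hom (psi i)) ->
  (forall i j, i \in s -> j \in s -> i != j ->
     forall x y, psi i x ** psi j y = 0) ->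
  star_hom (fun a : S => \sum_(i <- s) psi i (a i)).
Proof.
move=> us ph po; split=> [c x y|x y|x].
- rewrite scaler_sumr -big_split big_seq [RHS]big_seq; apply: eq_bigr => i is_.
  by rewrite c0valD c0valZ (homD (ph i is_)) (homZ (ph i is_)).
- elim: s us ph po => [|i s IH] /=; first by rewrite !big_nil csmul0l.
  move=> /andP[is_ us] ph po; rewrite !big_cons.
  have z1 : psi i (x i) ** (\sum_(j <- s) psi j (y j)) = 0.
    rewrite big_seq; apply: (big_ind (fun v => psi i (x i) ** v = 0)).
    - exact: csmul0r.
    - by move=> u v u0 v0; rewrite csmulDr u0 v0 addr0.
    - move=> j js; apply: po; rewrite ?mem_head ?inE ?js ?orbT//.
      by apply: contraNneq is_ => ->.
  have z2 : (\sum_(j <- s) psi j (x j)) ** psi i (y i) = 0.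
    rewrite big_seq; apply: (big_ind (fun v => v ** psi i (y i) = 0)).
    - exact: csmul0l.
    - by move=> u v u0 v0; rewrite csmulDl u0 v0 addr0.
    - move=> j js; apply: po; rewrite ?mem_head ?inE ?js ?orbT//.
      by apply: contraNneq is_ => <-.
  rewrite csmulDl !csmulDr z1 z2 addr0 add0r (homM (ph i (mem_head _ _))).
  congr (_ + _); apply: IH => // [j js|j k js ks].
    by apply: ph; rewrite inE js orbT.
  by apply: po; rewrite inE ?js ?ks orbT.
- have -> : (\sum_(i <- s) psi i (x i))^# = \sum_(i <- s) (psi i (x i))^#.
    elim: (s) => [|i t IH]; rewrite ?big_nil ?csadj0// !big_cons.
    by rewrite csadjD IH.
  rewrite big_seq [RHS]big_seq; apply: eq_bigr => i is_.
  by rewrite c0val_adj (homJ (ph i is_)).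
Qed.
End SumOfOrthogonal.

Section WeakProjectivity.
Context {R : realType} {I : countType} {A : I -> cstarType R}.
Local Notation S := (c0sum A : cstarType R).

(** The list [s] carries the elements of [l] up to [r / 2]; the other half of
    the error is shared by the summands with index in [s]. *)
Lemma approx_lift (B C : cstarType R) (phi : S -> C) (f : B -> C) :
  (forall i, weakly_projective (A i)) ->
  star_hom phi -> star_hom f -> set_surj setT setT f ->
  forall (l : seq S) (r : R), 0 < r -> exists th : S -> B,
    star_hom th /\ forall a, a \in l -> nr (f (th a) - phi a) <= r.
Proof.
move=> wA phih fh fs l r r0.
have r20 : 0 < r / 2 by rewrite divr_gt0.
have [s [us sr]] : exists s : seq I, uniq s /\
    forall a, a \in l -> forall i, i \notin s -> nr (a i) <= r / 2.
  suff [s sr] : exists s : seq I, forall a, a \in l ->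
      forall i, i \notin s -> nr (a i) <= r / 2.
    exists (undup s); split; first exact: undup_uniq.
    by move=> a al i; rewrite mem_undup; exact: sr.
  elim: l => [|a l [s sr]]; first by exists [::].
  have [t tr] := c0_tail a r20; exists (t ++ s) => b.
  rewrite inE => /orP[/eqP->|bl] i; rewrite mem_cat negb_or => /andP[it is_].
    exact: tr.
  exact: sr.
have pP i : exists p : A i, strictly_pos p.
  have [/separableP[d dP] _] := wA i; exact: exists_strictly_pos dP.
pose p i := projT1 (cid (pP i)).
have pp i : strictly_pos (p i) := projT2 (cid (pP i)).
pose ph i (x : A i) := phi (c0inj x).
have phh i : star_hom (@ph i) by exact: (star_hom_comp (c0inj_hom i) phih).
have pho i j : i != j -> forall x y, @ph i x ** @ph j y = 0.
  by move=> ij x y; rewrite /ph -(homM phih) c0inj_orth// (hom0 phih).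
have cT : csub [set: B] by [].
have [|E [E1 E2 E3]] :=
  orthogonal_family fh phh pho pp us cT (fun _ _ => Logic.I).
  move=> i _ x; have [b _ fb] := fs (ph i x) Logic.I; by exists b.
pose e := r / 2 / (size s).+1%:R.
have e0 : 0 < e by rewrite divr_gt0.
have psiP i : exists psi : A i -> B, i \in s -> [/\ star_hom psi,
    forall x, E i (psi x) & forall a, a \in l -> nr (f (psi (a i)) - ph i (a i)) <= e].
  have [is_|] := boolP (i \in s); last by exists (fun=> 0).
  have [c1 a1 _] := E1 i is_.
  have [psi [h1 h2 h3]] := weakly_projective_lift (phh i) fh c1 a1 (wA i) (E2 i is_).
  have [n nP] : exists n, forall m, (n <= m)%N -> forall a, a \in l ->
      nr (f (psi m (a i)) - ph i (a i)) <= e.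
    elim: (l) => [|a t [n nP]]; first by exists 0%N.
    have [N NP] := h3 (a i) e e0; exists (maxn n N) => m.
    rewrite geq_max => /andP[nm Nm] b; rewrite inE => /orP[/eqP->|bt].
      exact/ltW/NP.
    exact: nP.
  by exists (psi n) => _; split=> //; exact: nP.
pose psi i := projT1 (cid (psiP i)).
have psiP' i : i \in s -> [/\ star_hom (psi i), forall x, E i (psi i x) &
    forall a, a \in l -> nr (f (psi i (a i)) - ph i (a i)) <= e] :=
  projT2 (cid (psiP i)).
exists (fun a : S => \sum_(i <- s) psi i (a i)); split.
  apply: star_hom_sum => // [i /psiP'[]//|i j is_ js ij x y].
  have [_ Ei _] := psiP' i is_; have [_ Ej _] := psiP' j js.
  by have [] := E3 i j is_ js ij _ _ (Ei x) (Ej y).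
move=> a al.
pose a' : S := \sum_(i <- s) c0inj (a i).
have tail : nr (a' - a) <= r / 2.
  apply: c0nr_le => [|i]; first exact: ltW.
  rewrite c0valB /a' c0_sum_inj//; case: ifP => is_; first by rewrite subrr nr0 ltW.
  by rewrite sub0r nrN; apply: sr; rewrite ?is_.
have := nr_tri (phi a') (f (\sum_(i <- s) psi i (a i))) (phi a).
rewrite -(homB phih) => h; apply: le_trans h _; rewrite (splitr r); apply: lerD.
  rewrite /a' (hom_sum fh) (hom_sum phih) -sumrB.
  apply: le_trans (nr_sum _ _) _.
  have -> : r / 2 = e * (size s).+1%:R by rewrite divfK// pnatr_eq0.
  apply: (@le_trans _ _ (\sum_(i <- s) e)).
    rewrite big_seq [leRHS]big_seq; apply: ler_sum => i is_.
    by have [_ _] := psiP' i is_; apply.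
  rewrite big_const_seq count_predT iter_addr_0 -[leLHS]mulr_natr.
  by rewrite ler_wpM2l ?(ltW e0)// ler_nat.
by apply: le_trans (hom_contr phih _) tail.
Qed.

(** Homomorphisms are contractive, so approximation on a dense sequence is
    approximation everywhere. *)
Lemma weakly_projective_c0sum :
  (forall i, weakly_projective (A i)) -> weakly_projective S.
Proof.
move=> wA; have sepS : separable S by apply: separable_c0sum => i; case: (wA i).
split=> // B C phi f phih fh fs.
have [d dP] := (separableP S).1 sepS.
have n0 n : 0 < n.+1%:R^-1 :> R by rewrite invr_gt0.
have /choice[th thP] : forall n, exists th : S -> B, star_hom th /\
    forall k, (k < n)%N -> nr (f (th (d k)) - phi (d k)) <= n.+1%:R^-1.
  move=> n; have [th [thh thd]] :=
    approx_lift wA phih fh fs [seq d k | k <- iota 0 n] (n0 n).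
  exists th; split=> // k kn; apply: thd; apply/mapP; exists k => //.
  by rewrite mem_iota.
exists th; split=> [n|a]; first exact: (thP n).1.
apply/cvg0P => r r0.
have r40 : 0 < r / 4 by rewrite divr_gt0.
have [k kr] := dP a _ r40.
have := archi_boundP (ltW (divr_gt0 (ltr0n R 4) r0)).
set N := Num.bound _ => NP.
exists (maxn k.+1 N) => n; rewrite geq_max => /andP[kn Nn].
have [thh thd] := thP n.
have := nr_tri (f (th n (d k))) (f (th n a)) (phi a).
have := nr_tri (phi (d k)) (f (th n (d k))) (phi a).
have := hom_contr (star_hom_comp thh fh) (a - d k).
rewrite /= (homB thh) (homB fh).
have := hom_contr phih (d k - a); rewrite (homB phih) (nrB (d k)).
have := thd k kn.
have : n.+1%:R^-1 <= r / 4.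
  rewrite -(invrK (r / 4)) lef_pV2 ?posrE ?invr_gt0// invf_div.
  by apply: (le_trans (ltW NP)); rewrite ler_nat; apply: leq_trans Nn _.
move: kr; move: (nr (a - d k)) (n.+1%:R^-1) => q1 q2; lra.
Qed.

Lemma weakly_projective_summand i : separable (A i) ->
  weakly_projective S -> weakly_projective (A i).
Proof.
move=> sepA [_ wS]; split=> // B C phi f phih fh fs.
have [th [thh thc]] :=
  wS B C _ f (star_hom_comp (c0proj_hom i) phih) fh fs.
exists (fun n a => th n (c0inj a)); split=> [n|a].
  exact: (star_hom_comp (c0inj_hom i) (thh n)).
have := thc (c0inj a).
by have -> : (phi \o @c0proj R I A i) (c0inj a) = phi a
  by congr phi; exact: c0inj_in.
Qed.
End WeakProjectivity.

Theorem theorem6p2 (R : realType) (I : countType) (A : I -> cstarType R)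
    (sepA : forall i, separable (A i)) :
  weakly_projective (c0sum A : cstarType R) <->
  (forall i, weakly_projective (A i)).
Proof.
split=> [wS i|]; first exact: weakly_projective_summand (sepA i) wS.
exact: weakly_projective_c0sum.
Qed.
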